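(* Let $M$ be a smooth manifold, let $X_0,\dots,X_m\in\mathfrak X(M)$, and consider the control system $\dot x(t)=X_0(x(t))+\sum_{i=1}^m u_i(t)X_i(x(t))$ on $M$, its complete lifted system on $TM\setminus Z$, with flow $\phi^c_{t,u}$ under an admissible control $u$, and the induced projectivized system on $\mathbb P(TM)$. If the complete lifted system is controllable on $TM\setminus Z$, then the projectivized system is controllable on $\mathbb P(TM)$. Conversely, if the projectivized system is controllable on $\mathbb P(TM)$, then for every $(x,v),(y,w)\in TM\setminus Z$, there exist $t>0$, an admissible control $u$, and $\lambda\in\mathbb R^*$ such that $$\phi^c_{t,u}(x,v)=(y,\lambda w).$$
   Context: $\pi:TM\to M$ is the tangent bundle and $Z\subset TM$ its zero section. $\mathbb P(TM)=(TM\setminus Z)/\mathbb R^*$ is the quotient by scalar multiplication in the fibers, with canonical projection $q:TM\setminus Z\to\mathbb P(TM)$. For $f\in C^\infty(M)$, $f^c\in C^\infty(TM)$ is $f^c(v)=df(v)$. The complete lift of $X\in\mathfrak X(M)$ is the unique vector field $X^c\in\mathfrak X(TM)$ with $X^c(f^c)=(Xf)^c$ for all $f\in C^\infty(M)$; in induced coordinates $(x^i,v^i)$, if $X=X^i\partial_{x^i}$ then $X^c=X^i(x)\frac{\partial}{\partial x^i}+v^j\frac{\partial X^i}{\partial x^j}(x)\frac{\partial}{\partial v^i}$. The complete lifted control system is $\dot v(t)=X_0^c(v(t))+\sum_i u_i(t)X_i^c(v(t))$; it leaves $TM\setminus Z$ invariant. Each $X_i^c$ restricted to $TM\setminus Z$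 is $q$-related to a unique vector field $\widetilde X_i$ on $\mathbb P(TM)$, and the projectivized system is $\dot w(t)=\widetilde X_0(w(t))+\sum_i u_i(t)\widetilde X_i(w(t))$ on $\mathbb P(TM)$. Admissible controls form a fixed class $\mathcal U$ of locally bounded measurable functions $u:\mathbb R\to U\subset\mathbb R^m$, the same for all systems; solutions are absolutely continuous curves satisfying the differential equation for almost every $t$; $\phi^c_{t,u}(x,v)$ is the value at time $t$ of the solution of the lifted system with control $u$ starting at $(x,v)$ at time $0$ (where defined). A control system on a manifold $N$ is controllable on $N$ if for all $p,p'\in N$ there exist $t>0$ and an admissible control $u$ such that the solution with control $u$ starting at $p$ is defined up to time $t$ and equals $p'$ at time $t$. *)

(* Defs.v *)
From HB Require Import structures.
From mathcomp Require Import all_boot all_order all_algebra.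
From mathcomp Require Import all_classical all_reals all_analysis.
From mathcomp Require Import measurable_realfun.

Set Implicit Arguments.
Unset Strict Implicit.
Unset Printing Implicit Defensive.
Import Order.TTheory GRing.Theory Num.Theory.
Import numFieldNormedType.Exports.
Local Open Scope classical_set_scope.
Local Open Scope ring_scope.

(* On an open set [A] of a finite-dimensional space this is the class C^k. *)
Fixpoint Ck_on (R : realType) (V W : normedModType R) (k : nat) (A : set V)
    (f : V -> W) : Prop :=
  if k is k'.+1 then
    (forall x, A x -> differentiable f x) /\
    (forall v : V, Ck_on k' A ('D_v f))
  else forall x, A x -> {for x, continuous f}.

Definition smooth_on (R : realType) (V W : normedModType R) (A : set V)
  (f : V -> W) := forall k, Ck_on k A f.

(* A set with a family of maps [chart i] into R^n, each meaningful on
   [chart_dom i] only (its values elsewhere are junk). *)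
Record chartedSpace (R : realType) (n : nat) := ChartedSpace {
  carrier :> Type;
  chart_index : Type;
  chart_dom : chart_index -> set carrier;
  chart : chart_index -> carrier -> 'rV[R]_n
}.
Arguments chart_dom {R n} _ _.
Arguments chart {R n} _ _ _.

(* The topology making the charts homeomorphisms onto their images. *)
Definition chart_open (R : realType) (n : nat) (N : chartedSpace R n)
    (A : set N) :=
  forall i, exists2 B : set 'rV[R]_n, open B &
    forall p, chart_dom N i p -> (A p <-> B (chart N i p)).

Section chart_topology.
Context (R : realType) (n : nat) (N : chartedSpace R n).

HB.instance Definition _ := gen_eqMixin (carrier N).
HB.instance Definition _ := gen_choiceMixin (carrier N).

Let chart_openT : chart_open [set: N].
Proof. by move=> i; exists setT => //; exact: openT. Qed.

Let chart_openI : setI_closed (@chart_open R n N).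
Proof.
move=> A B oA oB i.
have [A' oA' hA] := oA i; have [B' oB' hB] := oB i.
exists (A' `&` B'); first exact: openI.
by move=> p ip; rewrite /setI /= hA// hB.
Qed.

Let chart_open_bigcup (I : Type) (f : I -> set N) :
  (forall i, chart_open (f i)) -> chart_open (\bigcup_i f i).
Proof.
move=> of_ j.
pose B i := sval (cid2 (of_ i j)).
have [oB hB] : (forall i, open (B i)) /\
    (forall i p, chart_dom N j p -> (f i p <-> B i (chart N j p))).
  by split=> i; rewrite /B; case: cid2.
exists (\bigcup_i B i); first exact: bigcup_open.
by move=> p jp; split=> -[i _ ?]; exists i => //; apply/hB.
Qed.

HB.instance Definition _ := isOpenTopological.Build (carrier N)
  chart_openT chart_openI chart_open_bigcup.

End chart_topology.

(* The coordinate expression [f \o (chart i)^-1] of [f] on the image of the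
   chart [i] (and [0] outside this image). *)
Definition coord_expr (R : realType) (n : nat) (N : chartedSpace R n)
    (V : normedModType R) (i : chart_index N) (f : N -> V) (y : 'rV[R]_n) : V :=
  xget 0 [set f p | p in [set p | chart_dom N i p /\ chart N i p = y]].

Record smooth_manifold (R : realType) (n : nat) (N : chartedSpace R n) : Prop :=
  SmoothManifold {
  chart_cover : forall p : N, exists i, chart_dom N i p;
  chart_inj : forall i (p p' : N), chart_dom N i p -> chart_dom N i p' ->
    chart N i p = chart N i p' -> p = p';
  chart_image_open : forall i j,
    open (chart N i @` (chart_dom N i `&` chart_dom N j));
  transition_smooth : forall i j,
    smooth_on (chart N i @` (chart_dom N i `&` chart_dom N j))
              (coord_expr i (chart N j));
  manifold_hausdorff : hausdorff_space N;
  manifold_second_countable : @second_countable N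
}.

Definition smooth_fun (R : realType) (n : nat) (N : chartedSpace R n)
    (f : N -> R) :=
  forall i, @smooth_on R 'rV[R]_n R^o (chart N i @` chart_dom N i)
                       (coord_expr (V := R^o) i f).

(* A tangent vector at [p] is the family of its components in all the charts
   around [p], related by the differentials of the transition maps. The
   components in the other charts are set to [0], so that equality of tangent
   vectors is Leibniz equality. *)
Definition tangent_family (R : realType) (n : nat) (N : chartedSpace R n)
    (p : N) (v : chart_index N -> 'rV[R]_n) : Prop :=
  (forall i j, chart_dom N i p -> chart_dom N j p ->
     v j = 'd (coord_expr i (chart N j)) (chart N i p) (v i)) /\
  (forall i, ~ chart_dom N i p -> v i = 0).

Record tangent (R : realType) (n : nat) (N : chartedSpace R n) := Tangent {
  tbase : N;
  tcomp : chart_index N -> 'rV[R]_n;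
  tcompP : tangent_family tbase tcomp
}.

Record vector_field (R : realType) (n : nat) (N : chartedSpace R n) :=
  VectorField {
  vf_at :> N -> tangent N;
  vf_base : forall p, tbase (vf_at p) = p;
  vf_smooth : forall i, smooth_on (chart N i @` chart_dom N i)
                                  (coord_expr i (fun p => tcomp (vf_at p) i))
}.

(* [df(v)], computed in any chart around the base point of [v]. *)
Definition dfun (R : realType) (n : nat) (N : chartedSpace R n) (f : N -> R)
    (v : tangent N) : R :=
  xget 0 [set r : R | exists2 i, chart_dom N i (tbase v) &
    r = 'd (coord_expr (V := R^o) i f) (chart N i (tbase v)) (tcomp v i)].

(* [Y (f p) = df (X p)] for all [p], for a smooth map [f]. *)
Definition vf_related (R : realType) (n n' : nat) (N : chartedSpace R n)
    (N' : chartedSpace R n') (f : N -> N') (X : vector_field N)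
    (Y : vector_field N') :=
  forall (p : N) i j, chart_dom N i p -> chart_dom N' j (f p) ->
    tcomp (Y (f p)) j =
    'd (coord_expr i (fun p' => chart N' j (f p'))) (chart N i p)
       (tcomp (X p) i).

(* The induced coordinates [(x, v)]. *)
Definition TM (R : realType) (n : nat) (M : chartedSpace R n) :
    chartedSpace R (n + n) :=
  @ChartedSpace R (n + n) (tangent M) (chart_index M)
    (fun i v => chart_dom M i (tbase v))
    (fun i v => row_mx (chart M i (tbase v)) (tcomp v i)).

(* [X f] is [p |-> df(X p)], and [f^c] is [dfun f] seen as a function on TM. *)
Definition complete_lift (R : realType) (n : nat) (M : chartedSpace R n)
    (X : vector_field M) (Xc : vector_field (TM M)) :=
  forall f : M -> R, smooth_fun f ->
    forall v : TM M,
      dfun (dfun f : TM M -> R) (Xc v) = dfun (fun p => dfun f (X p)) v.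

Lemma tangent_family_scale (R : realType) (n : nat) (N : chartedSpace R n)
    (lam : R) (v : tangent N) :
  tangent_family (tbase v) (fun i => lam *: tcomp v i).
Proof.
have [vE v0] := tcompP v; split=> [i j ip jp|i ip].
- by rewrite (vE i j ip jp) linearZ.
- by rewrite v0// scaler0.
Qed.

Definition tscale (R : realType) (n : nat) (N : chartedSpace R n) (lam : R)
    (v : tangent N) : tangent N :=
  Tangent (tangent_family_scale lam v).

Definition zero_section (R : realType) (n : nat) (M : chartedSpace R n) :
    set (TM M) :=
  [set v | forall i, tcomp v i = 0].

Record slit_tangent (R : realType) (n : nat) (M : chartedSpace R n) :=
  SlitTangent {
  slit_val : TM M;
  slitP : ~ zero_section slit_val
}.

Definition TM0 (R : realType) (n : nat) (M : chartedSpace R n) :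
    chartedSpace R (n + n) :=
  @ChartedSpace R (n + n) (slit_tangent M) (chart_index (TM M))
    (fun i v => chart_dom (TM M) i (slit_val v))
    (fun i v => chart (TM M) i (slit_val v)).

Definition TM0_incl (R : realType) (n : nat) (M : chartedSpace R n)
  (v : TM0 M) : TM M := slit_val v.

Lemma tscale_slit (R : realType) (n : nat) (M : chartedSpace R n) (lam : R)
    (lam0 : lam != 0) (v : slit_tangent M) :
  ~ @zero_section R n M (tscale lam (slit_val v)).
Proof.
move=> z; apply: (@slitP _ _ _ v) => i; apply/eqP.
by have /eqP := z i; rewrite /= scaler_eq0 (negPf lam0).
Qed.

Definition slit_scale (R : realType) (n : nat) (M : chartedSpace R n) (lam : R)
    (lam0 : lam != 0) (v : TM0 M) : TM0 M :=
  SlitTangent (@tscale_slit R n M lam lam0 v).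

Definition Rstar_orbit (R : realType) (n : nat) (M : chartedSpace R n)
    (v : TM0 M) : set (TM0 M) :=
  [set v' | exists lam (lam0 : lam != 0), v' = slit_scale lam0 v].

Record proj_tangent (R : realType) (n : nat) (M : chartedSpace R n) :=
  ProjTangent {
  proj_class : set (TM0 M);
  proj_classP : exists v, proj_class = Rstar_orbit v
}.

Definition proj_repr (R : realType) (n : nat) (M : chartedSpace R n)
  (L : proj_tangent M) : TM0 M := sval (cid (proj_classP L)).

(* The chart [(i, k)] is defined on the lines whose vectors have a nonzero k-th
   component in the chart [i]: it maps the line of [(x, v)] to
   [(x, v^1/v^k, ..., v^n/v^k)] with the k-th quotient left out. This does not
   depend on the representative of the line. *)
Definition PTM (R : realType) (n : nat) (M : chartedSpace R n) :
    chartedSpace R (n + n.-1) :=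
  @ChartedSpace R (n + n.-1) (proj_tangent M) (chart_index M * 'I_n)%type
    (fun ik L => let v := TM0_incl (proj_repr L) in
       chart_dom M ik.1 (tbase v) /\ tcomp v ik.1 ord0 ik.2 != 0)
    (fun ik L => let v := TM0_incl (proj_repr L) in
       row_mx (chart M ik.1 (tbase v))
         (col' ik.2 ((tcomp v ik.1 ord0 ik.2)^-1 *: tcomp v ik.1))).

Definition PTM_proj (R : realType) (n : nat) (M : chartedSpace R n)
    (v : TM0 M) : PTM M :=
  ProjTangent (ex_intro (fun w => Rstar_orbit v = Rstar_orbit w) v erefl).

Record control_system (R : realType) (n : nat) (N : chartedSpace R n)
    (m : nat) := ControlSystem {
  drift : vector_field N;
  controlled : 'I_m -> vector_field N
}.

Definition lifted_system (R : realType) (n m : nat) (M : chartedSpace R n)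
    (S : control_system M m) (Sc : control_system (TM M) m) :=
  complete_lift (drift S) (drift Sc) /\
  forall k, complete_lift (controlled S k) (controlled Sc k).

Definition system_related (R : realType) (n n' m : nat) (N : chartedSpace R n)
    (N' : chartedSpace R n') (f : N -> N') (S : control_system N m)
    (S' : control_system N' m) :=
  vf_related f (drift S) (drift S') /\
  forall k, vf_related f (controlled S k) (controlled S' k).

Definition velocity_comp (R : realType) (n m : nat) (N : chartedSpace R n)
    (S : control_system N m) (a : 'rV[R]_m) (p : N) (i : chart_index N) :
    'rV[R]_n :=
  tcomp (drift S p) i + \sum_(k < m) a ord0 k *: tcomp (controlled S k p) i.

Definition lebesgue_measurable_fun (R : realType) (f : R -> R) :=
  forall B : set R, measurable B ->
    completed_algebra_gen (@lebesgue_measure R) (f @^-1` B).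

Definition admissible_class (R : realType) (m : nat) (U : set 'rV[R]_m)
    (UU : set (R -> 'rV[R]_m)) :=
  forall u, UU u ->
    [/\ forall t, U (u t),
        forall k, lebesgue_measurable_fun (fun t => u t ord0 k) &
        [locally [bounded u t | t in [set: R]]]].

Definition abs_continuous (R : realType) (V : normedModType R) (a b : R)
    (f : R -> V) :=
  forall e : R, 0 < e -> exists2 d : R, 0 < d &
    forall s : seq (R * R),
      (forall I, I \in s -> [&& a <= I.1, I.1 <= I.2 & I.2 <= b]) ->
      pairwise (fun I J => (I.2 <= J.1) || (J.2 <= I.1)) s ->
      \sum_(I <- s) (I.2 - I.1) < d ->
      \sum_(I <- s) `|f I.2 - f I.1| < e.

(* Only the values of [g] on [0, T] matter. *)
Definition solution (R : realType) (n m : nat) (N : chartedSpace R n)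
    (S : control_system N m) (u : R -> 'rV[R]_m) (T : R) (g : R -> N) :=
  {within `[0, T], continuous g} /\
  forall (i : chart_index N) (a b : R), 0 <= a -> a <= b -> b <= T ->
    (forall t, t \in `[a, b] -> chart_dom N i (g t)) ->
    abs_continuous a b (fun t => chart N i (g t)) /\
    {ae lebesgue_measure, forall t : R, t \in `]a, b[ ->
      is_derive (t : R^o) (1 : R^o) (fun s => chart N i (g s))
                (velocity_comp S (u t) (g t) i)}.

(* The graph of the flow: [phi_(t,u)(p)] is defined and equal to [p']. *)
Definition flows_to (R : realType) (n m : nat) (N : chartedSpace R n)
    (S : control_system N m) (t : R) (u : R -> 'rV[R]_m) (p p' : N) :=
  exists g : R -> N, [/\ solution S u t g, g 0 = p & g t = p'].

Definition controllable (R : realType) (n m : nat) (N : chartedSpace R n)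
    (UU : set (R -> 'rV[R]_m)) (S : control_system N m) :=
  forall p p' : N, exists (t : R) (u : R -> 'rV[R]_m),
    [/\ 0 < t, UU u & flows_to S t u p p'].

(* Main.v *)
(* The projection [q] to the projectivized bundle sends solutions to solutions
   by the chain rule, which gives the first implication.

   Conversely, a solution [w] of the projectivized system is lifted chart by
   chart. If [e] is the lift of [w] whose k-th fibre coordinate is 1, then [r e]
   solves the lifted system as soon as [r' = mu r], where [mu] is the k-th fibre
   component of the velocity at [e]; so [r] is the exponential of a Lebesgue
   primitive of [mu]. This uses that complete lifts are homogeneous in the
   fibres. As they are given by their action on the functions [f^c], this needs
   a bump function [f] with [df(v) <> 0]; the relation to a field on the
   projectivization provides the rest. The local lifts are glued along [0, T],
   the initial vector of each being the final vector of the previous one. *)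

Require Import Defs.
From HB Require Import structures.
From mathcomp Require Import all_boot all_order all_algebra.
From mathcomp Require Import all_classical all_reals all_analysis.
From mathcomp Require Import measurable_realfun lra ring.
Set Implicit Arguments.
Unset Strict Implicit.
Unset Printing Implicit Defensive.
Import Order.TTheory GRing.Theory Num.Theory.
Import numFieldNormedType.Exports.
Local Open Scope classical_set_scope.
Local Open Scope ring_scope.

(** * Differentiability and the classes C^k *)

(** Controls are only measurable, so the velocity equation holds almost everywhere and [mu] is only
    Lebesgue measurable and bounded on the interval of a local lift. Its primitive is Lipschitz,
    which makes [r] absolutely continuous. As the equation for [r] is linear, its solution lives as
    long as [w] does and never vanishes: the lift neither blows up nor meets the zero section.
    Solutions are tested in every chart that contains an arc of the curve. A lift built in one chart
    must therefore be carried to the others, which rests on the stability of absolute continuity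
    under $C^1$ maps. The bundles are handled through explicit coordinate formulas, valid near each
    point of a chart image, in place of the junk values of [coord_expr]. *)

Section differentiability.
Context (R : realType) (V W : normedModType R).

(** A first-order expansion involves only the germ, and the differential is unique. This replaces a
    [coord_expr], known only near a point, by an explicit formula. *)
Lemma near_eq_is_diff (f g : V -> W) (x : V) : {near x, f =1 g} ->
  differentiable f x -> differentiable g x /\ 'd g x = 'd f x :> (V -> W).
Proof.
move=> fg df.
have dfc := diff_continuous df.
have E : g \o shift x = cst (g x) + 'd f x +o_0 id.
  have /diff_locallyP[_ /eqaddoP fE] := df.
  apply/eqaddoP => e e0; have := fE e e0.
  have fg0 : \forall y \near 0, f (y + x) = g (y + x).
    have := fg; rewrite (near_shift 0 x) /=.
    by apply: filterS => y /=; rewrite subr0.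
  apply: filterS2 fg0 => y /= fgy.
  by rewrite !fctE /= /shift fgy (nbhs_singleton fg).
have dE := diff_unique dfc E; split; last exact: dE.
by apply/diff_locallyP; rewrite dE.
Qed.

End differentiability.

Lemma near_eq_chain_rule (R : realType) (U V W : normedModType R) (f : U -> V)
    (g : V -> W) (h : U -> W) x y : f x = y -> differentiable f x ->
  differentiable g y -> {near x, h =1 g \o f} ->
  differentiable h x /\ forall v, 'd h x v = 'd g y ('d f x v).
Proof.
move=> <- df dg hgf; have dgf := differentiable_comp df dg.
have gfh : {near x, g \o f =1 h} by apply: filterS hgf => z ->.
have [dh dhE] := near_eq_is_diff gfh dgf; split => // v.
exact: (etrans (congr1 (@^~ v) dhE) (congr1 (@^~ v) (diff_comp df dg))).
Qed.

Section Ck.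
Context (R : realType).
Implicit Types (V W U : normedModType R) (k : nat).

(** Openness turns equality on [A] into equality of germs at its points, so the hypothesis passes to
    all directional derivatives. *)
Lemma Ck_on_ext V W (A : set V) (f g : V -> W) k : open A ->
  (forall x, A x -> f x = g x) -> Ck_on k A f -> Ck_on k A g.
Proof.
move=> oA; elim: k f g => [|k IH] f g fg /=.
  move=> fc x Ax; have nfg : {near x, f =1 g}.
    by near=> y; apply: fg; near: y; exact: open_nbhs_nbhs.
  change (g @ x --> g x); rewrite -fg//; apply: cvg_trans (fc x Ax).
  exact: near_eq_cvg.
move=> [df Cf]; have nfg x : A x -> {near x, f =1 g}.
  by move=> Ax; near=> y; apply: fg; near: y; exact: open_nbhs_nbhs.
split=> [x Ax|v]; first exact: (near_eq_is_diff (nfg x Ax) (df x Ax)).1.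
apply: IH (Cf v) => x Ax; exact/near_eq_derive/nfg.
Unshelve. all: by end_near. Qed.

Lemma Ck_on_sub V W (A B : set V) (f : V -> W) k : A `<=` B ->
  Ck_on k B f -> Ck_on k A f.
Proof.
move=> AB; elim: k f => [|k IH] f /=; first by move=> fc x /AB; exact: fc.
by move=> [df Cf]; split=> [x /AB/df//|v]; exact: IH.
Qed.

(** [Ck_on] is a pointwise condition on a map of the whole space, so smoothness may be checked piece
    by piece, as is done for bump functions. *)
Lemma Ck_on_setU V W (A B : set V) (f : V -> W) k :
  Ck_on k A f -> Ck_on k B f -> Ck_on k (A `|` B) f.
Proof.
elim: k f => [|k IH] f /=; first by move=> fA fB x []; [exact: fA|exact: fB].
move=> [dfA CfA] [dfB CfB]; split=> [x []|v]; [exact: dfA|exact: dfB|exact: IH].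
Qed.

Lemma Ck_onW V W (A : set V) (f : V -> W) k :
  Ck_on k.+1 A f -> Ck_on k A f.
Proof.
elim: k f => [|k IH] f [df Cf]; last by split=> // v; exact: IH.
by move=> x /df; exact: differentiable_continuous.
Qed.

Lemma Ck_on_cst V W (A : set V) (c : W) k : Ck_on k A (cst c).
Proof.
elim: k c => [|k IH] c; first by move=> x _; exact: cst_continuous.
split=> [x _|v]; first exact: differentiable_cst.
rewrite (_ : 'D_v (cst c) = cst 0); first exact: IH.
by apply/funext => x; rewrite derive_cst.
Qed.

Lemma Ck_onD V W (A : set V) (f g : V -> W) k : open A ->
  Ck_on k A f -> Ck_on k A g -> Ck_on k A (f + g).
Proof.
move=> oA; elim: k f g => [|k IH] f g.
  by move=> fc gc x Ax; apply: continuousD; [exact: fc|exact: gc].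
move=> [df Cf] [dg Cg]; split=> [x Ax|v].
  by apply: differentiableD; [exact: df|exact: dg].
apply: (Ck_on_ext oA _ (IH _ _ (Cf v) (Cg v))) => x Ax.
by rewrite deriveD//; apply: diff_derivable; [exact: df|exact: dg].
Qed.

Lemma Ck_onM V (A : set V) (f g : V -> R^o) k : open A ->
  Ck_on k A f -> Ck_on k A g -> Ck_on k A (fun x => f x * g x : R^o).
Proof.
move=> oA; elim: k f g => [|k IH] f g Cf Cg.
  by move=> x Ax; apply: continuousM; [exact: Cf|exact: Cg].
have [[df Cf'] [dg Cg']] := (Cf, Cg); split=> [x Ax|v].
  by apply: differentiableM; [exact: df|exact: dg].
have := Ck_onD oA (IH _ _ (Ck_onW Cf) (Cg' v)) (IH _ _ (Ck_onW Cg) (Cf' v)).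
apply: (Ck_on_ext oA) => x Ax.
by rewrite deriveM//; apply: diff_derivable; [exact: df|exact: dg].
Qed.

Lemma Ck_on_sum V W (A : set V) n (f : 'I_n -> V -> W) k : open A ->
  (forall i, Ck_on k A (f i)) -> Ck_on k A (fun x => \sum_i f i x).
Proof.
move=> oA Cf; apply: (@Ck_on_ext _ _ _ (\sum_i f i)) => //.
  by move=> x _; rewrite fct_sumE.
elim/big_ind : _ => //; first exact: Ck_on_cst.
by move=> *; exact: Ck_onD.
Qed.

Lemma Ck_on_linear V W (A : set V) (L : {linear V -> W}) k :
  continuous L -> Ck_on k A L.
Proof.
move=> cL; case: k => [|k]; first by move=> x _; exact: cL.
split=> [x _|v]; first exact: linear_differentiable.
rewrite (_ : 'D_v L = cst (L v)); first exact: Ck_on_cst.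
apply/funext => x; rewrite deriveE ?diff_lin//.
exact: linear_differentiable.
Qed.

Lemma Ck_on_lin_comp V W U (A : set V) (f : V -> W) (L : {linear W -> U}) k :
  open A -> continuous L -> Ck_on k A f -> Ck_on k A (L \o f).
Proof.
move=> oA cL; elim: k f => [|k IH] f Cf.
  by move=> x Ax; apply: continuous_comp; [exact: Cf|exact: cL].
have [df Cf'] := Cf; have dL y : differentiable L y by exact: linear_differentiable.
split=> [x Ax|v]; first by apply: differentiable_comp => //; exact: df.
apply: (Ck_on_ext oA _ (IH _ (Cf' v))) => x Ax.
rewrite [RHS]deriveE; last by apply: differentiable_comp => //; exact: df.
rewrite diff_comp//; last exact: df.
by rewrite /= diff_lin// deriveE//; exact: df.
Qed.

Lemma Ck_on_comp_lin V W U (A : set W) (f : W -> U) (L : {linear V -> W}) k :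
  open A -> continuous L -> Ck_on k A f -> Ck_on k (L @^-1` A) (f \o L).
Proof.
move=> oA cL; have oLA : open (L @^-1` A) by apply: open_comp => // x _; exact: cL.
have dL y : differentiable L y by exact: linear_differentiable.
elim: k f => [|k IH] f Cf.
  by move=> x Ax; apply: continuous_comp; [exact: cL|exact: Cf].
have [df Cf'] := Cf; split=> [x Ax|v].
  by apply: differentiable_comp => //; exact: df.
apply: (Ck_on_ext oLA _ (IH _ (Cf' (L v)))) => x Ax.
rewrite [RHS]deriveE; last by apply: differentiable_comp => //; exact: df.
rewrite diff_comp//; last exact: df.
by rewrite /= diff_lin// deriveE//; exact: df.
Qed.

(** Valued in [R^o] and declared linear, so that coordinates fall under the rules for linear
    maps. *)
Definition rcoord n (i : 'I_n) (x : 'rV[R]_n) : R^o := x ord0 i.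

Lemma rcoord_linear n (i : 'I_n) : linear (rcoord i).
Proof. by move=> a x y; rewrite /rcoord !mxE. Qed.

HB.instance Definition _ n (i : 'I_n) :=
  GRing.isLinear.Build R 'rV[R]_n R^o *:%R (rcoord i) (rcoord_linear i).

Lemma Ck_on_coord V n (A : set V) (f : V -> 'rV[R]_n) k i : open A ->
  Ck_on k A f -> Ck_on k A (fun x => f x ord0 i : R^o).
Proof.
move=> oA; apply: (@Ck_on_lin_comp _ _ _ _ _ (rcoord i)) => //.
exact: coord_continuous.
Qed.

End Ck.

(** * Absolutely continuous curves *)

Section interval_induction.
Context (R : realType).

(** The step at the supremum of the points satisfying [P] goes past that supremum unless it already
    reaches [b]. It allows any start [s] near [t], as gluing requires, and so replaces a finite
    subdivision of the interval. *)
Lemma interval_induction (a b : R) (P : R -> Prop) : a <= b -> P a ->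
  (forall t, a <= t <= b -> exists2 e, 0 < e &
     forall s s', a <= s -> s <= s' -> s' <= b -> t - e < s -> s' < t + e ->
       P s -> P s') ->
  P b.
Proof.
move=> ab Pa step; pose E := [set s | a <= s <= b /\ P s].
have Ea : E a by split => //; rewrite lexx.
have Eb : ubound E b by move=> s [/andP[]].
have hE : has_sup E by split; [exists a|exists b].
have at_ : a <= sup E by apply: ub_le_sup => //; exact: hE.2.
have tb : sup E <= b by apply: ge_sup => //; exists a.
have [|e e0 He] := step (sup E); first by rewrite at_.
have [s [/andP[as_ sb] Ps] ts] := sup_adherent e0 hE.
have sE : s <= sup E.
  by apply: ub_le_sup; [exact: hE.2|split => //; rewrite as_ sb].
have [eb|be] := ltP b (sup E + e); first exact: (He s b).
have h : sup E < sup E + e / 2 by rewrite ltrDl divr_gt0.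
suff : sup E + e / 2 <= sup E by rewrite leNgt h.
have h' : sup E + e / 2 < sup E + e.
  by rewrite ltrD2l ltr_pdivrMr// mulr_natr mulr2n ltrDl.
apply: ub_le_sup; first exact: hE.2.
split; first by rewrite (le_trans at_ (ltW h)) (le_trans (ltW h') be).
apply: (He s) => //; first exact: (le_trans sE (ltW h)).
exact: (le_trans (ltW h') be).
Qed.

End interval_induction.

Section absolute_continuity.
Context (R : realType).
Implicit Types (V W : normedModType R) (a b c : R).

Lemma ac_sub V (f : R -> V) a b c d : a <= c -> d <= b ->
  abs_continuous a b f -> abs_continuous c d f.
Proof.
move=> ac db fac e e0; have [r r0 Hr] := fac e e0; exists r => // s Hs.
apply: Hr => I /Hs /and3P[cI II Id].
by rewrite (le_trans ac cI) II (le_trans Id db).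
Qed.

(** Sums, products and Lipschitz images all reduce to this domination of increments. *)
Lemma ac_le_add V V' W (f : R -> V) (f' : R -> V') (g : R -> W) a b (C : R) :
  (forall s t, a <= s -> s <= t -> t <= b ->
     `|g t - g s| <= C * (`|f t - f s| + `|f' t - f' s|)) ->
  abs_continuous a b f -> abs_continuous a b f' -> abs_continuous a b g.
Proof.
(* [C] may be zero or negative, whereas one can divide by [D]. *)
move=> H fac f'ac e e0; pose D := Num.max 1 C.
have D1 : 0 < D by rewrite lt_max ltr01.
have e20 : 0 < e / 2 / D by rewrite !divr_gt0.
have [r r0 Hr] := fac _ e20; have [r' r'0 Hr'] := f'ac _ e20.
exists (Num.min r r'); first by rewrite lt_min r0.
move=> s Hs Ps; rewrite lt_min => /andP[sr sr'].
apply: (@le_lt_trans _ _ (\sum_(I <- s) D * (`|f I.2 - f I.1| + `|f' I.2 - f' I.1|))).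
  rewrite big_seq [leRHS]big_seq; apply: ler_sum => I /Hs /and3P[aI II Ib].
  apply: (le_trans (H _ _ aI II Ib)); apply: ler_wpM2r; first exact: addr_ge0.
  by rewrite le_max lexx orbT.
rewrite -mulr_sumr big_split/= -ltr_pdivlMl//.
apply: lt_le_trans (ltrD (Hr s Hs Ps sr) (Hr' s Hs Ps sr')) _.
by rewrite -mulrDl -splitr mulrC.
Qed.

Lemma ac_lipschitz V (f : R -> V) a b (C : R) :
  (forall s t, a <= s -> s <= t -> t <= b -> `|f t - f s| <= C * (t - s)) ->
  abs_continuous a b f.
Proof.
move=> H e e0; pose D := Num.max 1 C.
have D1 : 0 < D by rewrite lt_max ltr01.
exists (e / D); first by rewrite divr_gt0.
move=> s Hs _; rewrite ltr_pdivlMr// mulrC mulr_sumr; apply: le_lt_trans.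
rewrite big_seq [leRHS]big_seq; apply: ler_sum => I /Hs /and3P[aI II Ib].
apply: (le_trans (H _ _ aI II Ib)); apply: ler_wpM2r; first by rewrite subr_ge0.
by rewrite le_max lexx orbT.
Qed.

Lemma ac_cst V (c : V) a b : abs_continuous a b (cst c).
Proof.
apply: (@ac_lipschitz _ _ _ _ 0) => s t _ st _.
by rewrite subrr normr0 mul0r.
Qed.

Lemma ac_le V W (f : R -> V) (g : R -> W) a b (C : R) :
  (forall s t, a <= s -> s <= t -> t <= b -> `|g t - g s| <= C * `|f t - f s|) ->
  abs_continuous a b f -> abs_continuous a b g.
Proof.
move=> H fac; apply: (@ac_le_add _ _ _ f (cst (0 : V)) g _ _ C) => //; last exact: ac_cst.
by move=> s t *; rewrite subrr normr0 addr0; exact: H.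
Qed.

Lemma ac_ext V (f g : R -> V) a b : (forall t, a <= t <= b -> f t = g t) ->
  abs_continuous a b f -> abs_continuous a b g.
Proof.
move=> fg; apply: (@ac_le _ _ f g _ _ 1) => s t as_ st tb.
by rewrite mul1r !fg// ?as_ ?tb ?(le_trans as_ st)//= (le_trans st tb).
Qed.

Lemma acD V (f g : R -> V) a b : abs_continuous a b f -> abs_continuous a b g ->
  abs_continuous a b (fun t => f t + g t).
Proof.
apply: (@ac_le_add _ _ _ _ _ _ _ _ 1) => s t _ _ _.
by rewrite mul1r opprD addrACA ler_normD.
Qed.

Lemma ac_sum V n (f : 'I_n -> R -> V) a b : (forall i, abs_continuous a b (f i)) ->
  abs_continuous a b (fun t => \sum_i f i t).
Proof.
move=> fac; rewrite (_ : (fun _ => _) = \sum_i f i); last first.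
  by apply/funext => t; rewrite fct_sumE.
by elim/big_ind : _ => //; [exact: ac_cst|move=> *; exact: acD].
Qed.

(** Each interval is clipped at [b] from both sides. The clipped families are admissible on $[a,b]$
    and $[b,c]$, and $f(\min(x,b)) + f(\max(x,b)) = f(x) + f(b)$ shows that the two increments add
    up to that of [f]. *)
Lemma ac_glue V (f : R -> V) a b c :
  abs_continuous a b f -> abs_continuous b c f -> abs_continuous a c f.
Proof.
move=> fab fbc e e0; have e20 : 0 < e / 2 by rewrite divr_gt0.
have [r r0 Hr] := fab _ e20; have [r' r'0 Hr'] := fbc _ e20.
exists (Num.min r r'); first by rewrite lt_min r0.
move=> s Hs Ps; rewrite lt_min => /andP[sr sr'].
pose m (I : R * R) := (Num.min I.1 b, Num.min I.2 b).
pose M (I : R * R) := (Num.max I.1 b, Num.max I.2 b).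
(* The order of [a], [b], [c] is arbitrary: when [b] is not between the others, either $[a,c]$ lies
   in one of the two intervals or every interval of [s] is degenerate. *)
have [ab|ba] := leP a b; last first.
  have [cb|bc] := ltP c b.
    rewrite big_seq big1 ?e0// => I /Hs /and3P[aI II Ic].
    suff -> : I.2 = I.1 by rewrite subrr normr0.
    by apply/le_anti/andP; split=> //; apply: (le_trans Ic); apply: ltW; rewrite (lt_trans cb)// (lt_le_trans ba).
  have H2 : \sum_(I <- s) `|f I.2 - f I.1| < e / 2.
    apply: Hr' => // I /Hs /and3P[aI -> ->].
    by rewrite (le_trans (ltW ba)).
  by rewrite (lt_le_trans H2)// ler_pdivrMr// ler_peMr ?ltW// ltr1n.
have [bc|cb] := leP b c; last first.
  have H2 : \sum_(I <- s) `|f I.2 - f I.1| < e / 2.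
    apply: Hr => // I /Hs /and3P[-> -> Ic] /=.
    by rewrite (le_trans Ic) ?ltW.
  by rewrite (lt_le_trans H2)// ler_pdivrMr// ler_peMr ?ltW// ltr1n.
have minM x y : x <= y -> Num.min x b <= Num.min y b.
  by move=> xy; rewrite le_min !ge_min xy lexx orbT.
have maxM x y : x <= y -> Num.max x b <= Num.max y b.
  by move=> xy; rewrite ge_max !le_max xy lexx orbT.
have Hm : \sum_(I <- map m s) `|f I.2 - f I.1| < e / 2.
  apply: Hr.
  - move=> _ /mapP[I /Hs /and3P[aI II Ib]] -> /=.
    by rewrite le_min aI ab minM//= ge_min lexx orbT.
  - rewrite pairwise_map; apply: (sub_pairwise _ Ps) => I J /= /orP[] /minM ->//.
    by rewrite orbT.
  - rewrite big_map; apply: le_lt_trans sr.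
    rewrite big_seq [leRHS]big_seq; apply: ler_sum => I /Hs /and3P[_ II _] /=.
    by rewrite /Num.min; case: (ltP I.1 b); case: (ltP I.2 b) => // h1 h2; lra.
have HM : \sum_(I <- map M s) `|f I.2 - f I.1| < e / 2.
  apply: Hr'.
  - move=> _ /mapP[I /Hs /and3P[aI II Ib]] -> /=.
    by rewrite le_max lexx orbT maxM//= ge_max Ib.
  - rewrite pairwise_map; apply: (sub_pairwise _ Ps) => I J /= /orP[] /maxM ->//.
    by rewrite orbT.
  - rewrite big_map; apply: le_lt_trans sr'.
    rewrite big_seq [leRHS]big_seq; apply: ler_sum => I /Hs /and3P[_ II _] /=.
    by rewrite /Num.max; case: (ltP I.1 b); case: (ltP I.2 b) => // h1 h2; lra.
have := ltrD Hm HM; rewrite !big_map -splitr -big_split/=; apply: le_lt_trans.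
apply: ler_sum => I _.
have -> : f I.2 - f I.1 = (f (Num.min I.2 b) - f (Num.min I.1 b)) +
                          (f (Num.max I.2 b) - f (Num.max I.1 b)).
  have H x : f (Num.min x b) + f (Num.max x b) = f x + f b.
    by rewrite /Num.min /Num.max; case: (ltP x b) => _ //; rewrite addrC.
  rewrite addrACA H -opprD H opprD addrACA subrr addr0 //.
exact: ler_normD.
Qed.

Lemma ac_continuous V (f : R -> V) a b : abs_continuous a b f ->
  {within `[a, b], continuous f}.
Proof.
move=> fac; apply/subspace_continuousP => t; rewrite /= in_itv/= => /andP[at_ tb].
apply/cvgrPdist_lt => e e0; have [r r0 Hr] := fac e e0.
rewrite /nbhs/= /within/=; apply/nbhs_ballP; exists r => // s ts; rewrite /= in_itv/= => /andP[as_ sb].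
rewrite /ball/= in ts.
have [st|/ltW st] := leP s t.
  have := Hr [:: (s, t)]; rewrite !big_seq1/=; apply => //; last first.
    by move: ts; rewrite ger0_norm// subr_ge0.
  by move=> I; rewrite inE => /eqP -> /=; rewrite as_ st.
have := Hr [:: (t, s)]; rewrite !big_seq1/= distrC; apply => //; last first.
  by move: ts; rewrite distrC ger0_norm// subr_ge0.
by move=> I; rewrite inE => /eqP -> /=; rewrite at_ st.
Qed.

Lemma within_continuous_dist V (f : R -> V) a b t (e : R) :
  {within `[a, b], continuous f} -> a <= t <= b -> 0 < e ->
  exists2 d, 0 < d & forall s, a <= s <= b -> `|t - s| < d -> `|f t - f s| < e.
Proof.
move=> /subspace_continuousP fc tab e0; have ti : `[a, b]%classic t by rewrite /= in_itv.
have /cvgrPdist_lt/(_ _ e0) := fc t ti.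
rewrite /nbhs/= /within/= => /nbhs_ballP[d d0 Hd].
by exists d => // s sab ts; apply: Hd => //; rewrite /= in_itv.
Qed.

(** Absolute continuity on $[a,c]$ is propagated in [c] by gluing. Local Lipschitz estimates thereby
    suffice on a compact interval. *)
Lemma ac_local V (f : R -> V) a b :
  (forall t, a <= t <= b -> exists2 d, 0 < d & forall s s', a <= s -> s <= s' ->
    s' <= b -> t - d < s -> s' < t + d -> abs_continuous s s' f) ->
  abs_continuous a b f.
Proof.
move=> H; have [ab|ba] := leP a b; last first.
  move=> e e0; exists 1 => // s Hs _ _; rewrite big_seq big1// => I /Hs /and3P[aI II Ib].
  suff -> : I.2 = I.1 by rewrite subrr normr0.
  by apply/le_anti/andP; split => //; rewrite (le_trans Ib)// (le_trans (ltW ba)).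
apply: (@interval_induction _ a b (fun c => abs_continuous a c f)) => //.
  apply: (@ac_lipschitz _ _ _ _ 0) => s t as_ st ta.
  suff -> : t = s by rewrite subrr normr0 mul0r.
  by apply/le_anti; rewrite st (le_trans ta as_).
move=> t /H[d d0 Hd]; exists d => // s s' as_ ss' s'b ts s't fs.
by apply: (ac_glue fs); exact: Hd.
Qed.

End absolute_continuity.

(** * Absolute continuity under $C^1$ maps and products *)

Section C1_lipschitz.
Context (R : realType) (n : nat).

Lemma norm_coord_le (v : 'rV[R]_n) i : `|v ord0 i| <= `|v|.
Proof.
rewrite [leRHS]/Num.Def.normr/= mx_normrE.
exact: (le_trans _ (le_bigmax _ _ (ord0, i))).
Qed.

Lemma diff_sum_coord (W : normedModType R) (f : 'rV[R]_n -> W) x v :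
  differentiable f x -> 'd f x v = \sum_i v ord0 i *: 'D_(delta_mx ord0 i) f x.
Proof.
move=> df; rewrite {1}(row_sum_delta v) linear_sum.
by apply: eq_bigr => i _; rewrite linearZ deriveE.
Qed.

(** Continuity bounds the partial derivatives on a ball. Balls are convex, so the mean value theorem
    applies along the segment from [z] to [y]. *)
Lemma C1_lipschitz_near (A : set 'rV[R]_n) (f : 'rV[R]_n -> R^o) x :
  open A -> A x -> Ck_on 1 A f -> exists r C : R, 0 < r /\
    forall y z, ball x r y -> ball x r z -> `|f y - f z| <= C * `|y - z|.
Proof.
move=> oA Ax [df Cf]; pose e i : 'rV[R]_n := delta_mx ord0 i.
have Dc i : \forall y \near x, `|'D_(e i) f y| <= `|'D_(e i) f x| + 1.
  have /cvgrPdist_lt/(_ _ ltr01) : {for x, continuous ('D_(e i) f)} by exact: Cf.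
  apply: filterS => y; rewrite distrC => /ltW h.
  by rewrite -lerBlDl (le_trans _ h)// lerB_dist.
have : \forall y \near x, A y /\ forall i, `|'D_(e i) f y| <= `|'D_(e i) f x| + 1.
  near=> y; split; first by near: y; exact: open_nbhs_nbhs.
  by near: y; apply: filter_forall.
move=> /nbhs_ballP[r /= r0 Hr].
(* Each coordinate of [y - z] is at most its norm, so the bounds on the partial derivatives add
   up. *)
exists r, (\sum_i (`|'D_(e i) f x| + 1)); split => // y z xy xz.
pose p (s : R^o) : 'rV[R]_n := s *: (y - z) + z.
have pball s : 0 <= s <= 1 -> ball x r (p s).
  move=> /andP[s0 s1]; move: xy xz; rewrite -!ball_normE/= /ball_/= => xy xz.
  have -> : x - p s = s *: (x - y) + (1 - s) *: (x - z).
    apply/rowP => j; rewrite /p !mxE; ring.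
  apply: (le_lt_trans (ler_normD _ _)); rewrite !normrZ ger0_norm// ger0_norm ?subr_ge0//.
  have [->|sn0] := eqVneq s 0; first by rewrite mul0r add0r subr0 mul1r.
  have s0' : 0 < s by rewrite lt_neqAle eq_sym sn0.
  rewrite [ltRHS](_ : _ = s * r + (1 - s) * r); last by ring.
  apply: ltr_leD.
    by rewrite ltr_pM2l.
  by rewrite ler_wpM2l ?subr_ge0// ltW.
have dp s : is_diff (s : R^o) p ( *:%R ^~ (y - z)).
  by apply: is_diff_eq; rewrite addr0.
have dfp s : 0 <= s <= 1 -> is_diff (s : R^o) (f \o p) ('d f (p s) \o ( *:%R ^~ (y - z))).
  move=> /pball /Hr[Ap _]; apply: is_diff_comp.
  by apply: DiffDef => //; exact: df.
have [c c01] : exists2 c, c \in `]0, 1[%R &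
    (f \o p) 1 - (f \o p) 0 = ('d f (p c) (y - z)) * (1 - 0).
  apply: (@MVT _ (f \o p) (fun s => 'd f (p s) (y - z))) => //.
    move=> s; rewrite in_itv/= => /andP[/ltW s0 /ltW s1].
    have h : is_diff (s : R^o) (f \o p) ('d f (p s) \o ( *:%R ^~ (y - z))).
      by apply: dfp; rewrite s0.
    apply: DeriveDef; first exact: diff_derivable.
    by rewrite deriveE// diff_val/= scale1r.
  apply: continuous_in_subspaceT => s; rewrite inE/= in_itv/= => s01.
  by apply: differentiable_continuous; have [] := dfp _ s01.
rewrite /= /p scale1r scale0r add0r subrK subr0 mulr1 => ->.
have c01' : 0 <= c <= 1 by move: c01; rewrite in_itv/= => /andP[/ltW -> /ltW ->].
have [Apc Dpc] := Hr _ (pball _ c01').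
rewrite diff_sum_coord; last exact: df.
rewrite mulr_suml (le_trans (ler_norm_sum _ _ _))//; apply: ler_sum => i _.
rewrite normrZ mulrC; apply: ler_pM => //; exact: norm_coord_le.
Unshelve. all: by end_near. Qed.

(** By continuity, [g] stays for a short time in a ball on which [f] is Lipschitz; [ac_local] does
    the rest. *)
Lemma ac_C1_comp (A : set 'rV[R]_n) (f : 'rV[R]_n -> R^o) (g : R -> 'rV[R]_n) a b :
  open A -> (forall t, a <= t <= b -> A (g t)) -> Ck_on 1 A f ->
  abs_continuous a b g -> abs_continuous a b (fun t => f (g t)).
Proof.
move=> oA gA Cf gac; apply: ac_local => t tab.
have [r [C [r0 HC]]] := C1_lipschitz_near oA (gA _ tab) Cf.
have [d d0 Hd] := within_continuous_dist (ac_continuous gac) tab r0.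
have gball s : a <= s -> s <= b -> t - d < s -> s < t + d -> ball (g t) r (g s).
  move=> as_ sb ts st; rewrite -ball_normE/=; apply: Hd; first by rewrite as_.
  by rewrite distrC ltr_distl ts.
exists d => // s s' as_ ss' s'b ts s't.
apply: (@ac_le _ _ _ g _ _ _ C); last exact: ac_sub gac.
move=> u v su uv vs'; apply: HC; apply: gball.
- by rewrite (le_trans as_)// (le_trans su).
- exact: (le_trans vs').
- by rewrite (lt_le_trans ts)// (le_trans su).
- exact: (le_lt_trans vs').
- exact: (le_trans as_).
- by rewrite (le_trans uv)// (le_trans vs').
- exact: (lt_le_trans ts).
- by rewrite (le_lt_trans uv)// (le_lt_trans vs').
Qed.

Lemma ac_rowP (f : R -> 'rV[R]_n) a b :
  abs_continuous a b f <-> forall i, abs_continuous a b (fun t => f t ord0 i : R^o).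
Proof.
split=> [fac i|fac].
  apply: (@ac_le _ _ _ f _ _ _ 1) fac => s t _ _ _.
  rewrite mul1r; have := norm_coord_le (f t - f s) i; by rewrite !mxE.
rewrite (_ : f = fun t => \sum_i f t ord0 i *: delta_mx ord0 i); last first.
  by apply/funext => t; exact: row_sum_delta.
apply: ac_sum => i; apply: (@ac_le _ _ _ _ _ _ _ `|delta_mx ord0 i : 'rV[R]_n|) (fac i).
by move=> s t _ _ _; rewrite -scalerBl normrZ mulrC.
Qed.

Lemma within_continuous_bounded (V : normedModType R) (f : R -> V) a b : a <= b ->
  {within `[a, b], continuous f} -> exists C, forall t, a <= t <= b -> `|f t| <= C.
Proof.
move=> ab fc; have nc : {within `[a, b], continuous (fun t => `|f t|)}.
  by move=> x; apply: continuous_comp; [exact: fc|exact: norm_continuous].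
have [c _ Hc] := EVT_max ab nc; exists `|f c| => t tab.
by apply: Hc; rewrite in_itv.
Qed.

Lemma acM (f g : R -> R^o) a b : abs_continuous a b f -> abs_continuous a b g ->
  abs_continuous a b (fun t => f t * g t : R^o).
Proof.
move=> fac gac; have [ab|ba] := leP a b; last first.
  apply: (@ac_lipschitz _ _ _ _ _ 0) => s t as_ st tb.
  by have := le_lt_trans (le_trans as_ (le_trans st tb)) ba; rewrite ltxx.
have [C HC] := within_continuous_bounded ab (ac_continuous fac).
have [D HD] := within_continuous_bounded ab (ac_continuous gac).
apply: (@ac_le_add _ _ _ _ f g _ _ _ (Num.max C D)) fac gac => s t as_ st tb.
have -> : f t * g t - f s * g s = (f t - f s) * g t + f s * (g t - g s) by ring.
apply: (le_trans (ler_normD _ _)); rewrite !normrM mulrDr; apply: lerD.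
  rewrite mulrC ler_wpM2r// (le_trans (HD t _)) ?le_max ?lexx ?orbT//.
  by rewrite tb (le_trans as_ st).
by rewrite ler_wpM2r// (le_trans (HC s _)) ?le_max ?lexx// as_ (le_trans st).
Qed.

End C1_lipschitz.

(** * Primitives of Lebesgue measurable functions *)

Section lebesgue_primitive.
Context (R : realType).
Notation mu := (@lebesgue_measure R).

(* Lebesgue measurability on [D]: the library's measurable functions on [R]
   are the Borel ones. *)
Definition ae_measurable (D : set R) (f : R -> R) :=
  exists2 N, mu.-negligible N /\ measurable N & measurable_fun (D `\` N) f.

Lemma ae_measurable_sub (D E : set R) f : measurable E -> measurable D -> D `<=` E ->
  ae_measurable E f -> ae_measurable D f.
Proof.
move=> mE mD DE [N [nN mN] mf]; exists N => //.
by apply: measurable_funS mf; [exact: measurableD|exact: setSD].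
Qed.

Lemma measurable_ae (D : set R) f : measurable_fun D f -> ae_measurable D f.
Proof.
move=> mf; exists set0; last by rewrite setD0.
by split; [exact: negligible_set0|].
Qed.

Lemma ae_measurable2 (op : (R -> R) -> (R -> R) -> R -> R) (D : set R) f g :
  (forall E f g, measurable_fun E f -> measurable_fun E g ->
     measurable_fun E (op f g)) -> measurable D ->
  ae_measurable D f -> ae_measurable D g -> ae_measurable D (op f g).
Proof.
move=> mop mD [N [nN mN] mf] [N' [nN' mN'] mg]; exists (N `|` N').
  by split; [exact: negligibleU|exact: measurableU].
by apply: mop; [apply: measurable_funS mf|apply: measurable_funS mg];
  try exact: measurableD; apply: setDS; [exact: subsetUl|exact: subsetUr].
Qed.

Lemma ae_measurable_sum (D : set R) n (f : 'I_n -> R -> R) : measurable D ->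
  (forall i, ae_measurable D (f i)) -> ae_measurable D (fun t => \sum_i f i t).
Proof.
move=> mD mf; rewrite (_ : (fun _ => _) = \sum_i f i); last first.
  by apply/funext => t; rewrite fct_sumE.
elim/big_ind : _ => //; first exact/measurable_ae/measurable_cst.
move=> g h mg mh; apply: (ae_measurable2 (op := fun g h => g \+ h)) => //.
by move=> *; exact: measurable_funD.
Qed.

Lemma ae_measurableM (D : set R) f g : measurable D ->
  ae_measurable D f -> ae_measurable D g -> ae_measurable D (f \* g).
Proof.
move=> mD mf mg; apply: (ae_measurable2 (op := fun g h => g \* h)) => //.
by move=> *; exact: measurable_funM.
Qed.

(** For rational [q], the preimage of $]q,+\infty[$ is a Borel set up to a null set. Off the union
    of these countably many null sets, the preimage of $]a,+\infty[$ is the union of the Borel parts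
    over the rationals $q > a$. *)
Lemma lebesgue_ae_measurable (f : R -> R) :
  lebesgue_measurable_fun f -> ae_measurable setT f.
Proof.
move=> mf; pose A (q : rat) := f @^-1` `]ratr q, +oo[.
have HA q : exists BN : set R * set R, [/\ measurable BN.1, measurable BN.2,
    mu.-negligible BN.2, BN.1 `<=` A q & A q `\` BN.2 `<=` BN.1].
  have /mf[B mB [N [N' [mN' N'0 NN']] BN]] : measurable (`]ratr q, +oo[%classic : set R).
    exact: measurable_itv.
  exists (B, N'); split => //=.
  - by exists N'; split.
  - by rewrite /A -BN; exact: subsetUl.
  - by rewrite /A -BN => x [[//|/NN']].
have [BN HBN] := choice HA.
have mN : measurable (\bigcup_q (BN q).2).
  by apply: bigcupT_measurable_rat => q; have [] := HBN q.
exists (\bigcup_q (BN q).2).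
  (* The rationals are enumerated by [unpickle], with the empty set at integers that encode none. *)
  split => //; pose F n := if @unpickle rat n is Some q then (BN q).2 else set0.
  have NF : \bigcup_q (BN q).2 `<=` \bigcup_n F n.
    by move=> x [q _ Nx]; exists (pickle q); [exact: I|rewrite /F (pickleK q); exact: Nx].
  apply: (@negligibleS _ (measurableTypeR R) R mu _ _ NF).
  apply: (@negligible_bigcup _ (measurableTypeR R) R mu) => n; rewrite /F.
  case: unpickle => [q|]; last exact: negligible_set0.
  by have [] := HBN q.
move=> mD; apply: (measurability _ (RGenOInfty.measurableE R)) => //.
move=> /= _ [_ [a ->] <-].
rewrite [X in measurable X](_ : _ = \bigcup_(q : rat)
  (if a < ratr q then (BN q).1 `\` \bigcup_q (BN q).2 else set0)).
  apply: bigcupT_measurable_rat => q; case: ifPn => // _.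
  by apply: measurableD => //; have [] := HBN q.
apply/seteqP; split=> [x [[_ Nx]]|x [q _]] /=.
  rewrite in_itv/= andbT => /rat_in_itvoo[q]; rewrite in_itv/= => /andP[aq qx].
  exists q => //; rewrite aq; split => //.
  have [_ _ _ _] := HBN q; apply; split.
    by rewrite /A/= in_itv/= qx.
  by move=> Nq; apply: Nx; exists q.
case: ifPn => // aq [Bx Nx]; split=> //.
have [_ _ _ /(_ _ Bx)] := HBN q; rewrite /A/= !in_itv/= !andbT => qx _.
exact: lt_trans qx.
Qed.

(** The Lipschitz estimate serves twice: it makes [F] absolutely continuous, and it bounds [F], so
    that the exponential is Lipschitz on its range. *)
Lemma lebesgue_primitive (f : R -> R) a b C : ae_measurable `[a, b] f ->
  (forall t, a <= t <= b -> `|f t| <= C) ->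
  exists F : R -> R, [/\ F a = 0,
    forall s t, a <= s -> s <= t -> t <= b -> `|F t - F s| <= C * (t - s) &
    {ae mu, forall t, t \in `]a, b[ -> is_derive (t : R^o) (1 : R^o) (F : R^o -> R^o) (f t)}].
Proof.
move=> [N [nN mN] mf] fC.
have mab : measurable (`[a, b]%classic `\` N).
  by apply: measurableD => //; exact: measurable_itv.
(* Extension by 0 gives a Borel function on the whole line. It differs from [f] on $[a,b]$ only on a
   null set, which an almost everywhere derivative does not see. *)
pose h := f \_ (`[a, b] `\` N).
have mh : measurable_fun setT h by exact/(measurable_restrictT _ _).1.
have hC t : a <= t <= b -> `|h t| <= C.
  move=> tab; rewrite /h patchE; case: ifPn => _; first exact: fC.
  by rewrite normr0 (le_trans _ (fC t tab)).
have intab : mu.-integrable `[a, b] (EFin \o h).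
  apply: measurable_bounded_integrable.
  - exact: measurable_itv.
  - by rewrite /= lebesgue_measure_itv/=; case: ifP => // _; rewrite -EFinD ltry.
  - exact: measurable_funTS.
  - exists C; split; first exact: num_real.
    by move=> x Cx t; rewrite /= in_itv/= => /hC/le_trans; apply; exact: ltW.
have inth : mu.-integrable setT (EFin \o h).
  rewrite (_ : EFin \o h = (EFin \o h) \_ `[a, b]).
    by apply/integrable_restrict; rewrite ?setTI//; exact: measurable_itv.
  apply/funext => t; rewrite patchE; case: ifPn => // tab.
  by rewrite /= /h patchE ifF//; apply/negP; rewrite inE => -[]; move/negP : tab; rewrite inE.
pose F x := (\int[mu]_(t in `[a, x]) h t)%R.
have Fa : F a = 0 by rewrite /F set_itv1 Rintegral_set1.
exists F; split => //.
  move=> s t as_ st tb.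
  rewrite /F Rintegral_itvB//; [|by apply: integrableS inth => //; exact: measurable_itv
                              | by rewrite bnd_simp..].
  have ist : mu.-integrable `]s, t] (EFin \o h).
    by apply: integrableS inth => //; exact: measurable_itv.
  apply: (le_trans (le_normr_Rintegral _ ist)); first exact: measurable_itv.
  apply: (@le_trans _ _ (\int[mu]_(x in `]s, t]) C)).
    apply: le_Rintegral; [exact: measurable_itv| | |].
    - exact: (integrable_norm ist).
    - apply: measurable_bounded_integrable; [exact: measurable_itv| |exact: measurable_cst|].
      + by rewrite /= lebesgue_measure_itv/=; case: ifP => // _; rewrite -EFinD ltry.
      + exists `|C|; split; first exact: num_real.
        by move=> x Cx u _; exact: ltW.
    - move=> x; rewrite /= in_itv/= => /andP[sx xt]; apply: hC.
      by rewrite (le_trans as_ (ltW sx)) (le_trans xt).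
  rewrite Rintegral_cst; last exact: measurable_itv.
  rewrite [X in C * fine X]lebesgue_measure_itv /= lte_fin; case: ifPn => [_|].
    by rewrite -EFinD.
  by rewrite -leNgt => ts; rewrite mulr0 (_ : s = t) ?subrr ?mulr0//; apply/le_anti/andP.
have := @FTC1 R h (BLeft a).
have int1 y : mu.-integrable [set` Interval (BLeft a) (BRight y)] (EFin \o h).
  by apply: integrableS inth => //; exact: measurable_itv.
have loch : locally_integrable setT h.
  by apply: open_integrable_locally => //; exact: openT.
move=> /(_ int1 loch); have nN' : {ae mu, forall t, ~ N t}.
  by apply: negligibleS nN => x /contrapT.
apply: filterS2 nN' => t Nt H; rewrite in_itv/= => /andP[at_ tb].
have [dF F't] := H at_; split; first exact: dF.
rewrite -derive1E F't /h patchE mem_set//; split => //.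
by rewrite /= in_itv/= !ltW.
Qed.

End lebesgue_primitive.

(** * Bump functions and coordinates on the tangent bundle *)

Section flat_functions.
Context (R : realType).

(* The index [n] makes the span of these functions stable under derivation. *)
Definition flat_exp (n : nat) (s : R^o) : R^o :=
  if 0 < s then s^-1 ^+ n * expR (- s^-1) else 0.

(** This is $e^x \ge x^{n+2}/(n+2)!$ at $x = 1/s$. The exponent $n+2$ leaves a quadratic bound, so
    that the difference quotient at 0 tends to 0. *)
Lemma flat_exp_le n (s : R) : `|flat_exp n s| <= (n.+2)`!%:R * s ^+ 2.
Proof.
rewrite /flat_exp; case: ifPn => s0; last first.
  by rewrite normr0 mulr_ge0 ?ler0n// sqr_ge0.
have s1 : 0 < s^-1 by rewrite invr_gt0.
rewrite ger0_norm; last by rewrite mulr_ge0 ?expR_ge0 ?exprn_ge0 ?ltW.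
rewrite expRN ler_pdivrMr ?expR_gt0//.
have f0 : (0 : R) < (n.+2)`!%:R by rewrite ltr0n fact_gt0.
have H : s^-1 ^+ n.+2 / (n.+2)`!%:R <= expR s^-1.
  by apply: (le_trans _ (expR_ge1Dxn n.+1 (ltW s1))); rewrite lerDr ler01.
have -> : s^-1 ^+ n = (n.+2)`!%:R * s ^+ 2 * (s^-1 ^+ n.+2 / (n.+2)`!%:R).
  rewrite 2![s^-1 ^+ _.+1]exprS; move: f0; set q := _`!%:R => /lt0r_neq0 q0.
  by field; rewrite q0 gt_eqF.
by apply: ler_wpM2l => //; rewrite mulr_ge0 ?ltW// exprn_gt0.
Qed.

Lemma is_derive_flat_exp n (s : R^o) :
  is_derive s (1 : R^o) (flat_exp n) (- (n%:R * flat_exp n.+1 s) + flat_exp n.+2 s : R^o).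
Proof.
have [s0|s0|->] := ltgtP s 0.
- rewrite /flat_exp !ltNge !ltW//= mulr0 oppr0 addr0.
  apply: (@near_eq_is_derive _ _ _ (cst 0)).
  by near=> t; rewrite ltNge ltW//; near: t; exact: lt_nbhsl.
- pose g (t : R^o) : R^o := t^-1.
  apply: (@near_eq_is_derive _ _ _ (g ^+ n * (expR \o (- g))) ).
    near=> t; rewrite /flat_exp ifT//; first by rewrite exprfctE.
    by near: t; exact: lt_nbhsr.
  have sn0 : s != 0 by rewrite gt_eqF.
  have dg : is_derive s (1 : R^o) g (- s ^- 2 *: (1 : R^o)).
    exact: (@is_deriveV R id).
  have dg' : is_derive s (1 : R^o) (- g) (- (- s ^- 2 *: (1 : R^o))).
    exact: is_deriveN.
  have de : is_derive s (1 : R^o) (expR \o (- g)) (expR (- s^-1) * (- (- s ^- 2 *: (1 : R^o)))).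
    by apply: is_derive1_comp.
  have dp := is_deriveX n dg.
  apply: (is_derive_eq (is_deriveM dp de)).
  rewrite /flat_exp s0 /g exprfctE /= /GRing.scale /= !mulr1 opprK.
  rewrite -exprVn !exprS expr0 mulr1.
  case: n {dp} => [|n] /=; first by rewrite !mul0r mulr0 oppr0 addr0 add0r; ring.
  rewrite !exprS; ring.
- rewrite /flat_exp ltxx mulr0 oppr0 addr0.
  have H : (h^-1 *: (flat_exp n (h *: (1 : R^o) + 0) - flat_exp n 0) : R^o) @[h --> 0^'] --> (0 : R^o).
    have nn : (0 : R) < (n.+2)`!%:R by rewrite ltr0n fact_gt0.
    apply/cvgrPdist_lt => e e0; near=> h.
    have hn0 : h != 0 by near: h; exact: nbhs_dnbhs_neq.
    rewrite sub0r normrN addr0 {2}/flat_exp ltxx subr0 /GRing.scale /= mulr1.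
    rewrite normrM normfV.
    have h0 : 0 < `|h| by rewrite normr_gt0.
    have hs : `|h| < e / (n.+2)`!%:R.
      by near: h; apply: dnbhs0_lt; rewrite divr_gt0.
    rewrite mulrC ltr_pdivrMr// (le_lt_trans (flat_exp_le _ _))//.
    by rewrite -real_normK ?num_real// expr2 mulrA ltr_pM2r// mulrC -ltr_pdivlMr.
  split; first by apply/cvg_ex; exists 0; exact: H.
  exact: (cvg_lim _ H).
Unshelve. all: by end_near. Qed.

(** The induction on [k] is for all [n] at once, since differentiation raises [n] by one and by
    two. *)
Lemma Ck_on_flat_exp (V : normedModType R) (A : set V) (h : V -> R^o) n k :
  open A -> Ck_on k A h -> Ck_on k A (flat_exp n \o h).
Proof.
move=> oA; elim: k n => [|k IH] n.
  move=> hc x Ax; apply: continuous_comp; first exact: hc.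
  apply: differentiable_continuous; apply/derivable1_diffP.
  by have [] := is_derive_flat_exp n (h x).
move=> Ch; have [dh Ch'] := Ch.
have dfl s : differentiable (flat_exp n : R^o -> R^o) s.
  by apply/derivable1_diffP; have [] := is_derive_flat_exp n s.
split=> [x Ax|v]; first by apply: differentiable_comp => //; exact: dh.
have Chk := Ck_onW Ch.
have H1 : Ck_on k A (fun x => (- n%:R) * flat_exp n.+1 (h x) + flat_exp n.+2 (h x) : R^o).
  apply: Ck_onD => //; last exact: IH.
  by apply: (Ck_onM oA); [exact: Ck_on_cst|exact: IH].
apply: (Ck_on_ext oA _ (Ck_onM oA H1 (Ch' v))) => x Ax.
rewrite [RHS]deriveE; last by apply: differentiable_comp => //; exact: dh.
rewrite diff_comp//; last exact: dh.
rewrite /= -(deriveE v (dh _ Ax)).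
(* Written as a multiple of 1, the direction turns the differential of [flat_exp n] into its
   derivative. *)
set c : R^o := 'D_v h x; have -> : c = c *: (1 : R^o) by rewrite /GRing.scale/= mulr1.
rewrite linearZ /= -deriveE//; have [_ ->] := is_derive_flat_exp n (h x).
by rewrite /GRing.scale /= mulr1 mulrC mulNr.
Qed.

End flat_functions.

Section row_differentiable.
Context (R : realType) (V : normedModType R) (n : nat).

Lemma differentiable_row (f : V -> 'rV[R]_n) x :
  (forall j, differentiable (fun y => f y ord0 j : R^o) x) -> differentiable f x.
Proof.
move=> df.
rewrite (_ : f = \sum_j (fun y => f y ord0 j *: delta_mx ord0 j)); last first.
  by apply/funext => y; rewrite fct_sumE; exact: row_sum_delta.
by apply: differentiable_sum => j; exact: differentiableZl.
Qed.

Lemma diff_coord (f : V -> 'rV[R]_n) x v j : differentiable f x ->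
  ('d f x v) ord0 j = 'd (fun y => f y ord0 j : R^o) x v.
Proof.
move=> df; have cj : continuous (@rcoord R n j) by exact: coord_continuous.
have dL := @linear_differentiable _ _ _ (@rcoord R n j) (f x) cj.
rewrite (_ : (fun y => _) = @rcoord R n j \o f)// (diff_comp df dL).
by rewrite /= (@diff_lin _ _ _ (@rcoord R n j) (f x) cj).
Qed.

End row_differentiable.

(** In $\sum_b v^b\,\partial_b f(x)$ one derivative of [f] is lost, hence the assumption at all
    orders. *)
Lemma Ck_on_tangent_map (R : realType) n (A : set 'rV[R]_n) (f : 'rV[R]_n -> R^o) k :
  open A -> (forall k, Ck_on k A f) ->
  Ck_on k (lsubmx @^-1` A) (fun y : 'rV[R]_(n + n) => 'd f (lsubmx y) (rsubmx y) : R^o).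
Proof.
move=> oA Cf; have cL : continuous (lsubmx : 'rV[R]_(n + n) -> _) by exact: continuous_lsubmx.
have oT : open (lsubmx @^-1` A : set 'rV[R]_(n + n)).
  by apply: open_comp => // x _; exact: cL.
apply: (@Ck_on_ext _ _ _ _ (fun y => \sum_b rsubmx y ord0 b *
    'D_(delta_mx ord0 b) f (lsubmx y) : R^o)) => //.
  move=> y Ay; rewrite diff_sum_coord//; have [+ _] := Cf 1; exact.
apply: Ck_on_sum => // b; apply: Ck_onM => //.
  apply: Ck_on_coord => //; apply: (@Ck_on_linear _ _ _ _ rsubmx).
  exact: continuous_rsubmx.
apply: (@Ck_on_comp_lin _ _ _ _ A ('D_(delta_mx ord0 b) f) lsubmx) => //.
by have [_] := Cf k.+1; apply.
Qed.

(** * Coordinate expressions and the charts of the tangent bundle *)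

Section atlas.
Context (R : realType) (n : nat) (N : chartedSpace R n).

(** The property by which [coord_expr] is evaluated. It is isolated so as to apply equally to $M$,
    $TM$ and the slit bundle. *)
Definition injective_charts := forall i (p p' : N), chart_dom N i p ->
  chart_dom N i p' -> chart N i p = chart N i p' -> p = p'.

Hypothesis injN : injective_charts.

Lemma coord_exprK (V : normedModType R) i (f : N -> V) p :
  chart_dom N i p -> coord_expr i f (chart N i p) = f p.
Proof.
move=> ip; rewrite /coord_expr; apply: (@xget_unique _ 0); first by exists p.
by move=> _ [q [iq qp] <-]; rewrite (injN iq ip qp).
Qed.

(* [dfun] computed in a given chart, instead of the chart chosen by [xget]. *)
Lemma dfunE (f : N -> R) (v : tangent N) i :
  (forall j k, chart_dom N j (tbase v) -> chart_dom N k (tbase v) ->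
     [/\ differentiable (coord_expr (V := R^o) j f) (chart N j (tbase v)),
         differentiable (coord_expr j (chart N k)) (chart N j (tbase v)) &
         nbhs (chart N j (tbase v)) (chart N j @` (chart_dom N j `&` chart_dom N k))]) ->
  chart_dom N i (tbase v) ->
  dfun f v = 'd (coord_expr (V := R^o) i f) (chart N i (tbase v)) (tcomp v i).
Proof.
move=> df ip; rewrite /dfun; apply: (@xget_unique _ 0); first by exists i.
move=> _ [j jp ->]; have [vE _] := tcompP v; rewrite (vE i j ip jp).
have [dfi dt nb] := df i j ip jp; have [dfj _ _] := df j i jp ip.
set fi := coord_expr i f in dfi *; set fj := coord_expr j f in dfj *.
set t := coord_expr i (chart N j) in dt *.
have tE : t (chart N i (tbase v)) = chart N j (tbase v) by exact: coord_exprK.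
have E : {near chart N i (tbase v), fi =1 fj \o t}.
  by apply: filterS nb => _ [q [iq jq] <-] /=; rewrite /fi /fj /t !coord_exprK.
have [_ dE] := near_eq_chain_rule tE dt dfj E.
exact: (esym (dE _)).
Qed.

End atlas.

Section tangent_bundle.
Context (R : realType) (n : nat) (M : chartedSpace R n) (hM : smooth_manifold M).
Notation D := (chart_dom M).
Notation phi := (chart M).

Let injM : injective_charts M := chart_inj hM.

Definition transition i j := coord_expr i (phi j).
Definition overlap i j := phi i @` (D i `&` D j).

Lemma overlap_open i j : open (overlap i j).
Proof. exact: chart_image_open. Qed.

Lemma overlapP i j p : D i p -> D j p -> overlap i j (phi i p).
Proof. by move=> ip jp; exists p. Qed.

Lemma overlap_nbhs i j p : D i p -> D j p -> nbhs (phi i p) (overlap i j).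
Proof. by move=> ip jp; apply: open_nbhs_nbhs; split; [exact: overlap_open|exact: overlapP]. Qed.

Lemma transitionE i j p : D i p -> transition i j (phi i p) = phi j p.
Proof. by move=> ip; rewrite /transition coord_exprK. Qed.

Lemma transition_Ck k i j : Ck_on k (overlap i j) (transition i j).
Proof. exact: transition_smooth. Qed.

Lemma transition_diff i j p : D i p -> D j p -> differentiable (transition i j) (phi i p).
Proof. by move=> ip jp; have [+ _] := transition_Ck 1 i j; apply; exact: overlapP. Qed.

Lemma transition_cocycle i j k p v : D i p -> D j p -> D k p ->
  'd (transition j k) (phi j p) ('d (transition i j) (phi i p) v) =
  'd (transition i k) (phi i p) v.
Proof.
move=> ip jp kp; have dij := transition_diff ip jp.
have djk := transition_diff jp kp.
have E : {near phi i p, transition i k =1 transition j k \o transition i j}.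
  by apply: filterS (overlap_nbhs ip jp) => _ [q [iq jq] <-] /=; rewrite !transitionE.
have [_ dE] := near_eq_chain_rule (transitionE j ip) dij djk E.
exact: (esym (dE v)).
Qed.

Lemma transition_refl i p v : D i p -> 'd (transition i i) (phi i p) v = v.
Proof.
move=> ip; have E : {near phi i p, id =1 transition i i}.
  by apply: filterS (overlap_nbhs ip ip) => _ [q [iq jq] <-] /=; rewrite transitionE.
have did : is_diff (phi i p) id id by exact: is_diff_id.
have [_ dE] := near_eq_is_diff E (@ex_diff _ _ _ _ _ _ _ did).
exact: (etrans (congr1 (@^~ v) dE) (congr1 (@^~ v) (@diff_val _ _ _ _ _ _ _ did))).
Qed.

(** The components in the other charts are forced; they are compatible by the cocycle identity, and
    [transition_refl] gives back [v] in the chart [i]. *)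
Lemma tangent_exists i p v : D i p -> exists2 w : tangent M, tbase w = p & tcomp w i = v.
Proof.
move=> ip.
pose c j := if pselect (D j p) then 'd (transition i j) (phi i p) v else 0.
have cE j : D j p -> c j = 'd (transition i j) (phi i p) v.
  by rewrite /c; case: pselect.
have cP : tangent_family p c.
  split=> [j k jp kp|j jp]; last by rewrite /c; case: pselect.
  rewrite cE// cE//; exact: (esym (transition_cocycle v ip jp kp)).
exists (Tangent cP) => //=; rewrite cE//; exact: transition_refl.
Qed.

Lemma tangent_eq (v w : tangent M) i : D i (tbase v) -> tbase v = tbase w ->
  tcomp v i = tcomp w i -> v = w.
Proof.
case: v w => p v vP [p' w wP] /= ip pp' vw; subst p'.
suff ? : v = w by subst w; congr Tangent; exact: Prop_irrelevance.
apply/funext => j; have [vE v0] := vP; have [wE w0] := wP.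
have [jp|jp] := pselect (D j p); last by rewrite v0// w0.
by rewrite (vE _ _ ip jp) (wE _ _ ip jp) vw.
Qed.

Lemma TM_inj : injective_charts (TM M).
Proof.
move=> i v w /= iv iw /eq_row_mx[/(injM iv iw) vw].
exact: tangent_eq.
Qed.

Lemma TM0_inj : injective_charts (TM0 M).
Proof.
move=> i v w /= iv iw /(TM_inj iv iw).
case: v w iv iw => v vP [w wP] /= _ _ vw; subst w.
congr SlitTangent; exact: Prop_irrelevance.
Qed.

Definition tangent_transition i j (y : 'rV[R]_(n + n)) : 'rV[R]_(n + n) :=
  row_mx (transition i j (lsubmx y)) ('d (transition i j) (lsubmx y) (rsubmx y)).

Definition tangent_overlap i j : set 'rV[R]_(n + n) := lsubmx @^-1` overlap i j.

Lemma tangent_overlap_open i j : open (tangent_overlap i j).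
Proof. apply: open_comp; [by move=> x _; exact: continuous_lsubmx|exact: overlap_open]. Qed.

Lemma tangent_transitionE i j (v : TM M) : D i (tbase v) -> D j (tbase v) ->
  tangent_transition i j (chart (TM M) i v) = chart (TM M) j v.
Proof.
move=> iv jv; rewrite /tangent_transition /= row_mxKl row_mxKr transitionE//.
by have [vE _] := tcompP v; rewrite (vE i j).
Qed.

Lemma tangent_transition_Ck k i j l :
  Ck_on k (tangent_overlap i j) (fun y => tangent_transition i j y ord0 l : R^o).
Proof.
have oO := @overlap_open i j; have oT := @tangent_overlap_open i j.
have cL : continuous (lsubmx : 'rV[R]_(n + n) -> _) by exact: continuous_lsubmx.
case: (split_ordP l) => a ->.
  apply: (@Ck_on_ext _ _ _ _ ((fun x => transition i j x ord0 a : R^o) \o lsubmx)) => //.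
    by move=> y _ /=; rewrite row_mxEl.
  apply: (@Ck_on_comp_lin _ _ _ _ (overlap i j) _ lsubmx) => //.
  by apply: Ck_on_coord => //; exact: transition_Ck.
apply: (@Ck_on_ext _ _ _ _ (fun y => 'd (fun x => transition i j x ord0 a : R^o)
    (lsubmx y) (rsubmx y) : R^o)) => //.
  move=> y [p [ip jp] py]; rewrite row_mxEr diff_coord// -py.
  exact: transition_diff.
apply: Ck_on_tangent_map => // k'; apply: Ck_on_coord => //; exact: transition_Ck.
Qed.

Lemma tangent_transition_diff i j y : tangent_overlap i j y ->
  differentiable (tangent_transition i j) y.
Proof.
move=> oy; apply: differentiable_row => l.
by have [+ _] := tangent_transition_Ck 1 i j l; apply.
Qed.

(** Lets a statement about nearby coordinates in $TM$ be proved on nearby tangent vectors. *)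
Lemma TM_image i j (y : 'rV[R]_(n + n)) : tangent_overlap i j y ->
  exists2 v : TM M, D i (tbase v) /\ D j (tbase v) & chart (TM M) i v = y.
Proof.
move=> [p [ip jp] py]; have [w wp wi] := tangent_exists (rsubmx y) ip.
exists w; first by rewrite wp.
by rewrite /= wp wi py hsubmxK.
Qed.

End tangent_bundle.

(** * Bump functions supported in a chart *)

Section bump.
Context (R : realType) (n : nat) (M : chartedSpace R n) (hM : smooth_manifold M).
Notation D := (chart_dom M).
Notation phi := (chart M).
Let injM : injective_charts M := chart_inj hM.

(** The inverse chart is continuous on [K], so the preimage is compact, hence closed in a Hausdorff
    space. Extension by 0 outside a chart is smooth for this reason. *)
Lemma compact_chart_preimage i (K : set 'rV[R]_n) : compact K ->
  K `<=` phi i @` D i -> closed ([set q | D i q /\ K (phi i q)] : set M).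
Proof.
move=> cK KD; apply: compact_closed; first exact: manifold_hausdorff.
have [[x0 Kx0]|K0] := pselect (exists x, K x); last first.
  rewrite (_ : [set _ | _] = set0); first exact: compact0.
  by apply/seteqP; split => // q [_ Kq]; apply: K0; exists (phi i q).
have [p0 _ _] := KD _ Kx0.
pose psi x : M := xget p0 [set q | D i q /\ phi i q = x].
have psiP x : K x -> D i (psi x) /\ phi i (psi x) = x.
  by move=> /KD[q iq qx]; apply: (@xgetPex _ p0 [set q | D i q /\ phi i q = x]); exists q.
rewrite (_ : [set _ | _] = psi @` K); last first.
  apply/seteqP; split => [q [iq Kq]|_ [x Kx <-]] /=.
    exists (phi i q) => //; have [ip pE] := psiP _ Kq; exact: injM pE.
  by have [ip ->] := psiP _ Kx.
apply: continuous_compact cK; apply/subspace_continuousP => x Kx A.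
rewrite nbhsE => -[A' [oA' A'x] A'A]; have [B oB HB] := oA' i.
have [ix xE] := psiP _ Kx.
rewrite /nbhs/= /within/=.
have : nbhs x B by apply: open_nbhs_nbhs; split => //; rewrite -xE; apply/HB.
apply: filterS => y By Ky; apply: A'A; have [iy yE] := psiP _ Ky.
by apply/HB => //; rewrite yE.
Qed.

(** In a chart [j], the overlap with [i] and the complement of the closed set over [K] cover the
    image. On the first the function is [g] after a change of chart, on the second it vanishes. *)
Lemma smooth_fun_by_chart i (g : 'rV[R]_n -> R^o) (K : set 'rV[R]_n) :
  compact K -> K `<=` phi i @` D i ->
  (forall x, ~ K x -> g x = 0) ->
  (forall j k, Ck_on k (overlap j i) (g \o transition j i)) ->
  smooth_fun (fun q => if pselect (D i q) then g (phi i q) else 0).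
Proof.
move=> cK KD g0 Cg j k; set f := fun q => _.
have [B oB HB] := closed_openC (compact_chart_preimage cK KD) j.
have fE q : D i q -> f q = g (phi i q) by rewrite /f; case: pselect.
apply: (@Ck_on_sub _ _ _ _ (overlap j i `|` (overlap j j `&` B))).
  move=> _ [q jq <-]; have [Kq|Kq] := pselect (D i q /\ K (phi i q)).
    by left; exists q => //; split => //; case: Kq.
  right; split; [by exists q|]; by apply/HB.
have ov a : open (overlap j a) by exact: overlap_open.
apply: Ck_on_setU.
  apply: (@Ck_on_ext _ _ _ _ (g \o transition j i)) => // _ [q [jq iq] <-] /=.
  by rewrite transitionE// coord_exprK// fE.
have oA : open (overlap j j `&` B) by exact: openI.
apply: (@Ck_on_ext _ _ _ _ (cst 0)) => //; last exact: Ck_on_cst.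
move=> _ [[q [jq _] <-] /HB Bq]; rewrite coord_exprK//.
have nK := Bq jq; rewrite /f; case: pselect => // iq; apply/esym/g0 => Kq.
exact: nK.
Qed.

Lemma Ck_on_const_sub_sqr (V : normedModType R) (A : set V) (t : V -> 'rV[R]_n)
    (c : 'rV[R]_n) (r : R) k : open A -> Ck_on k A t ->
  Ck_on k A (fun y => r - \sum_a (t y ord0 a - c ord0 a) ^+ 2 : R^o).
Proof.
move=> oA Ct; apply: (@Ck_on_ext _ _ _ _ (fun y => r + \sum_a
    ((-1) * ((t y ord0 a + - c ord0 a) * (t y ord0 a + - c ord0 a))) : R^o)) => //.
  move=> y _; rewrite -sumrN; congr (_ + _); apply: eq_bigr => a _.
  by rewrite expr2 mulN1r.
apply: Ck_onD => //; first exact: Ck_on_cst.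
apply: Ck_on_sum => // a; apply: (Ck_onM oA); first exact: Ck_on_cst.
have H : Ck_on k A (fun y => t y ord0 a + - c ord0 a : R^o).
  by apply: Ck_onD => //; [exact: Ck_on_coord|exact: Ck_on_cst].
exact: (Ck_onM oA).
Qed.

(** The difference quotient is exactly $L - hs$, with $L$ the claimed value and $s = \sum_a
    (v^a)^2$. *)
Lemma derive_const_sub_sqr (c x v : 'rV[R]_n) (r : R) :
  'D_v (fun y : 'rV[R]_n => r - \sum_a (y ord0 a - c ord0 a) ^+ 2 : R^o) x =
  - \sum_a 2 * (x ord0 a - c ord0 a) * v ord0 a.
Proof.
apply: cvg_lim; first exact: Rhausdorff.
pose s := \sum_a v ord0 a ^+ 2; pose L := - \sum_a 2 * (x ord0 a - c ord0 a) * v ord0 a.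
have : (fun h : R => L - h * s : R^o) @ 0^' --> (L : R^o).
  rewrite -[X in _ --> X]subr0 -[X in _ --> (_ - X)](mul0r s).
  apply: cvg_within_filter; apply: cvgB; first exact: cvg_cst.
  by apply: cvgM; [exact: cvg_id|exact: cvg_cst].
apply: cvg_trans; apply: near_eq_cvg; near=> h.
have h0 : h != 0 by near: h; exact: nbhs_dnbhs_neq.
rewrite [X in _ *: X](_ : _ = \sum_a ((x ord0 a - c ord0 a) ^+ 2 -
    ((h *: v + x) ord0 a - c ord0 a) ^+ 2)); last by rewrite sumrB opprB addrC addrA subrK.
rewrite /L /s /GRing.scale/= !mulr_sumr -sumrN -sumrB; apply: eq_bigr => a _.
by rewrite !mxE; field.
Unshelve. all: by end_near. Qed.

(* The bump is centred at [phi i p - e v] rather than at [phi i p], so that its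
   differential at [p] does not kill [v]. *)
Lemma bump_exists i p (v : 'rV[R]_n) : D i p -> v != 0 ->
  exists2 f : M -> R, smooth_fun f &
    'd (coord_expr (V := R^o) i f) (phi i p) v != 0.
Proof.
move=> ip v0; pose s := \sum_a v ord0 a ^+ 2.
have s0 : 0 < s.
  rewrite lt_neqAle sumr_ge0 ?andbT; last by move=> a _; exact: sqr_ge0.
  apply: contra v0 => /eqP/esym/eqP; rewrite psumr_eq0; last by move=> a _; exact: sqr_ge0.
  move=> /allP v0; apply/eqP/rowP => a; rewrite mxE; apply/eqP.
  by have /implyP/(_ isT) := v0 a (mem_index_enum _); rewrite sqrf_eq0.
have /nbhs_ballP[r /= r0 Hr] := overlap_nbhs hM ip ip.
(* The cube [K] of half-width [2 * rho] must lie in the ball of radius [r]. *)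
pose rho := r / 3; have rho0 : 0 < rho by rewrite divr_gt0.
(* The factor $1+s$ exceeds both $|v^a|$ and $\sqrt s$. Hence [c] is within [rho] of [phi i p] in
   each coordinate, and [phi i p] lies strictly inside the Euclidean ball of radius [rho] about
   [c]. *)
pose e := rho / (1 + s); have e0 : 0 < e by rewrite divr_gt0// addr_gt0.
have es : e * (1 + s) = rho by rewrite /e divfK// gt_eqF// addr_gt0.
pose c := phi i p - e *: v.
pose K := [set x : 'rV[R]_n | forall a, `[phi i p ord0 a - 2 * rho, phi i p ord0 a + 2 * rho]%classic (x ord0 a)].
have cK : compact K.
  apply: (@rV_compact _ _ (fun a => `[phi i p ord0 a - 2 * rho, phi i p ord0 a + 2 * rho]%classic)).
  by move=> a; exact: segment_compact.
have KB x : K x -> ball (phi i p) r x.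
  move=> Kx; rewrite -ball_normE/=; apply: (@le_lt_trans _ _ (2 * rho)); last by rewrite /rho; lra.
  rewrite [leLHS]/Num.Def.normr/= mx_normrE; apply: bigmax_le => [|[z a] _]; first by rewrite mulr_ge0// ltW.
  rewrite ord1 !mxE/= ler_norml; have := Kx a; rewrite /= in_itv/= => /andP[h1 h2].
  by apply/andP; split; lra.
have KD : K `<=` phi i @` D i by move=> x /KB/Hr[q [iq _] <-]; exists q.
pose h (x : 'rV[R]_n) : R^o := rho ^+ 2 - \sum_a (x ord0 a - c ord0 a) ^+ 2.
(* Where [h] is positive, each coordinate is within [rho] of that of [c], hence within [2 * rho] of
   that of [phi i p]. *)
have hK x : ~ K x -> h x <= 0.
  move=> nK; rewrite leNgt; apply/negP => hx; apply: nK => a.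
  have H1 : (x ord0 a - c ord0 a) ^+ 2 < rho ^+ 2.
    rewrite -subr_gt0; apply: (lt_le_trans hx); rewrite lerD2l lerN2.
    by rewrite (bigD1 a)//= lerDl sumr_ge0// => b _; exact: sqr_ge0.
  have H2 : v ord0 a ^+ 2 <= s.
    by rewrite /s (bigD1 a)//= lerDl sumr_ge0// => b _; exact: sqr_ge0.
  have H3 : `|x ord0 a - c ord0 a| < rho.
    by rewrite -(@ltr_pXn2r _ 2)// ?nnegrE ?ltW// real_normK ?num_real.
  have H4 : `|v ord0 a| <= 1 + s.
    have := H2; rewrite -real_normK ?num_real//; have := normr_ge0 (v ord0 a).
    move: `|v ord0 a| => w w0 ws; nra.
  have H5 : `|e * v ord0 a| <= rho by rewrite normrM gtr0_norm// -es ler_wpM2l// ltW.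
  move: H3 H5; rewrite /c !mxE ltr_norml ler_norml /= in_itv/= => /andP[a1 a2] /andP[b1 b2].
  by apply/andP; split; lra.
pose g := flat_exp 0 \o h.
exists (fun q => if pselect (D i q) then g (phi i q) else 0).
  apply: (smooth_fun_by_chart cK KD).
    by move=> x /hK hx; rewrite /g /= /flat_exp ltNge hx.
  move=> j k; have ov : open (overlap j i) by exact: overlap_open.
  apply: (@Ck_on_flat_exp _ _ _ (h \o transition j i)) => //.
  by apply: Ck_on_const_sub_sqr => //; exact: transition_Ck.
have Ch : Ck_on 1 setT h.
  apply: (@Ck_on_const_sub_sqr _ setT idfun c (rho ^+ 2) 1); first exact: openT.
  by apply: Ck_on_linear => y; exact: cvg_id.
have dh : differentiable h (phi i p) by have [+ _] := Ch; apply.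
have dfl t : differentiable (flat_exp 0 : R^o -> R^o) t.
  by apply/derivable1_diffP; have [] := is_derive_flat_exp 0 t.
have E : {near phi i p, coord_expr (V := R^o) i (fun q => if pselect (D i q) then g (phi i q) else 0) =1 g}.
  apply: filterS (overlap_nbhs hM ip ip) => _ [q [iq _] <-] /=.
  by rewrite coord_exprK//; case: pselect.
have [_ ->] := near_eq_chain_rule erefl dh (dfl _) E.
rewrite -(deriveE v dh) derive_const_sub_sqr.
set w := - _; have -> : w = w *: (1 : R^o) by rewrite /GRing.scale/= mulr1.
rewrite linearZ /= -deriveE//; have [_ ->] := is_derive_flat_exp 0 (h (phi i p)).
rewrite /GRing.scale/= mul0r oppr0 add0r mulf_neq0//.
  (* As [phi i p - c] is [e *: v], the derivative of [h] along [v] is $-2es$. *)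
  rewrite /w oppr_eq0 (_ : \sum_a _ = 2 * e * s); last first.
    by rewrite mulr_sumr; apply: eq_bigr => a _; rewrite /c !mxE; ring.
  by apply: lt0r_neq0; rewrite mulr_gt0// mulr_gt0.
have hp : 0 < h (phi i p).
  rewrite /h (_ : \sum_a _ = e ^+ 2 * s); last first.
    by rewrite mulr_sumr; apply: eq_bigr => a _; rewrite /c !mxE; ring.
  by rewrite -es subr_gt0; nra.
by rewrite /flat_exp hp gt_eqF// mulr_gt0 ?expR_gt0// exprn_gt0// invr_gt0.
Qed.

End bump.

(** * Homogeneity of complete lifts *)

Section complete_lift.
Context (R : realType) (n : nat) (M : chartedSpace R n) (hM : smooth_manifold M).
Notation D := (chart_dom M).
Notation phi := (chart M).
Let injM : injective_charts M := chart_inj hM.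

Variables (f : M -> R) (smf : smooth_fun f).
Let fi i := coord_expr (V := R^o) i f.

Lemma smooth_fun_Ck k i : Ck_on k (overlap i i) (fi i).
Proof. by apply: Ck_on_sub (smf i k) => _ [p [ip _] <-]; exists p. Qed.

Lemma smooth_fun_diff i p : D i p -> differentiable (fi i) (phi i p).
Proof. by move=> ip; have [+ _] := smooth_fun_Ck 1 i; apply; exists p. Qed.

Lemma smooth_dfunE (v : tangent M) i : D i (tbase v) ->
  dfun f v = 'd (fi i) (phi i (tbase v)) (tcomp v i).
Proof.
move=> iv; apply: (dfunE injM) => // j k jv kv; split.
- exact: smooth_fun_diff.
- exact: (transition_diff hM).
- exact: (overlap_nbhs hM).
Qed.

(** Needed to evaluate $(Xf)^c$ in a chart of one's choice. *)
Lemma smooth_dfun_vf_diff (X : vector_field M) i p : D i p ->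
  differentiable (coord_expr (V := R^o) i (fun q => dfun f (X q))) (phi i p).
Proof.
move=> ip; have ov : open (overlap i i) by exact: (overlap_open hM).
have C1 : Ck_on 1 (overlap i i) (fun x => \sum_b coord_expr i (fun q => tcomp (X q) i) x ord0 b *
    'D_(delta_mx ord0 b) (fi i) x : R^o).
  apply: Ck_on_sum => // b; apply: Ck_onM => //.
    apply: Ck_on_coord => //; apply: Ck_on_sub (vf_smooth X i 1) => _ [q [iq _] <-].
    by exists q.
  by have [_] := smooth_fun_Ck 2 i; apply.
have [dC _] := C1; have {dC}H := dC _ (overlapP ip ip).
refine (near_eq_is_diff _ H).1.
apply: filterS (overlap_nbhs hM ip ip) => _ [q [iq _] <-].
rewrite !coord_exprK// (@smooth_dfunE _ i) ?vf_base//.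
exact: (esym (diff_sum_coord _ (smooth_fun_diff iq))).
Qed.

(** The coordinate expression of $f^c$ in the chart [i] of $TM$, in a form that is visibly linear on
    fibres. *)
Definition lift_coord i (y : 'rV[R]_(n + n)) : R^o := 'd (fi i) (lsubmx y) (rsubmx y).

Lemma lift_coord_Ck k i : Ck_on k (tangent_overlap i i) (lift_coord i).
Proof.
by apply: Ck_on_tangent_map => [|k']; [exact: (overlap_open hM)|exact: smooth_fun_Ck].
Qed.

Lemma tangent_overlap_nbhs (i j : chart_index M) (v : TM M) : D i (tbase v) -> D j (tbase v) ->
  nbhs (chart (TM M) i v) (tangent_overlap i j).
Proof.
move=> iv jv; apply: open_nbhs_nbhs; split; first exact: (tangent_overlap_open hM).
by rewrite /tangent_overlap/= row_mxKl; exact: overlapP.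
Qed.

Lemma lift_coord_diff (i : chart_index M) (v : TM M) : D i (tbase v) ->
  differentiable (lift_coord i) (chart (TM M) i v).
Proof.
move=> iv; have [+ _] := lift_coord_Ck 1 i; apply.
by have /nbhs_singleton := tangent_overlap_nbhs iv iv.
Qed.

Lemma coord_expr_dfun (i : chart_index M) y : tangent_overlap i i y ->
  coord_expr (N := TM M) (V := R^o) i (dfun f) y = lift_coord i y.
Proof.
move=> /(TM_image hM)[v [iv _] <-]; rewrite (coord_exprK (TM_inj hM))//.
by rewrite (@smooth_dfunE _ i)// /lift_coord row_mxKl row_mxKr.
Qed.

Lemma dfun_dfunE (w : tangent (TM M)) (i : chart_index M) : D i (tbase (tbase w)) ->
  dfun (dfun f : TM M -> R) w = 'd (lift_coord i) (chart (TM M) i (tbase w)) (tcomp w i).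
Proof.
move=> iw.
have E j : D j (tbase (tbase w)) -> {near chart (TM M) j (tbase w),
    lift_coord j =1 coord_expr (N := TM M) (V := R^o) j (dfun f)}.
  move=> jw; apply: filterS (tangent_overlap_nbhs jw jw) => y /coord_expr_dfun h.
  exact: esym.
have [_ dE] := near_eq_is_diff (E _ iw) (lift_coord_diff iw).
refine (etrans _ (congr1 (@^~ (tcomp w i)) dE)).
apply: (dfunE (TM_inj hM)) => // j k jw kw; split.
- exact: (near_eq_is_diff (E _ jw) (lift_coord_diff jw)).1.
- have Ht : {near chart (TM M) j (tbase w), @tangent_transition R n M j k =1
      coord_expr (N := TM M) j (chart (TM M) k)}.
    apply: filterS (@tangent_overlap_nbhs j k _ jw kw) => y /(TM_image hM)[v [jv kv] <-].
    by rewrite (tangent_transitionE hM)// (coord_exprK (TM_inj hM)).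
  refine (near_eq_is_diff Ht _).1; apply: (tangent_transition_diff hM).
  by have /nbhs_singleton := @tangent_overlap_nbhs j k _ jw kw.
- apply: filterS (@tangent_overlap_nbhs j k _ jw kw) => y /(TM_image hM)[v [jv kv] <-].
  by exists v.
Qed.

(** By the defining identity $X^c(f^c) = (Xf)^c$, each side is a value of $d(Xf)$, which is linear
    on the fibre. *)
Lemma complete_lift_scale X Xc (hX : complete_lift X Xc) (v : TM M) (i : chart_index M) (lam : R) :
  D i (tbase v) ->
  'd (lift_coord i) (chart (TM M) i (tscale lam v)) (tcomp (Xc (tscale lam v)) i) =
  lam * 'd (lift_coord i) (chart (TM M) i v) (tcomp (Xc v) i).
Proof.
move=> iv.
have H (w : TM M) : D i (tbase w) -> 'd (lift_coord i) (chart (TM M) i w) (tcomp (Xc w) i) =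
    'd (coord_expr (V := R^o) i (fun p => dfun f (X p))) (phi i (tbase w)) (tcomp w i).
  move=> iw; have := hX f smf w; rewrite (@dfun_dfunE _ i) ?vf_base//.
  move=> ->; apply: (dfunE injM) => // j k jw kw; split.
  - exact: smooth_dfun_vf_diff.
  - exact: (transition_diff hM).
  - exact: (overlap_nbhs hM).
have e : forall (g : {linear 'rV[R]_n -> R^o}) x, g (lam *: x) = lam * g x.
  by move=> g x; rewrite linearZ.
exact: (etrans (H (tscale lam v) iv) (etrans (e _ _) (congr1 ( *%R lam) (esym (H v iv))))).
Qed.

End complete_lift.

Lemma Ck_on_inv (R : realType) (V : normedModType R) (A : set V) (h : V -> R^o) k :
  open A -> (forall x, A x -> h x != 0) -> Ck_on k A h ->
  Ck_on k A (fun x => (h x)^-1 : R^o).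
Proof.
move=> oA h0; elim: k h h0 => [|k IH] h h0 Ch.
  by move=> x Ax; apply: continuousV; [exact: h0|exact: Ch].
have [dh Ch'] := Ch; split=> [x Ax|v].
  by apply: differentiableV; [exact: dh|exact: h0].
have Ci := IH _ h0 (Ck_onW Ch).
have := Ck_onM oA (Ck_on_cst A (-1 : R^o) k) (Ck_onM oA (Ck_onM oA Ci Ci) (Ch' v)).
apply: (Ck_on_ext oA) => x Ax /=.
have dx : derivable h x v by apply: diff_derivable; exact: dh.
rewrite deriveV//; last exact: h0.
by rewrite /GRing.scale/= -exprVn expr2; ring.
Qed.

(** * The projection $q$ in fibre coordinates *)

Section fibre_coordinates.
Context (R : realType) (n : nat).
Implicit Types (y h : 'rV[R]_(n + n)) (k : 'I_n).

Lemma coord_diff (l : 'I_(n + n)) y h : differentiable (fun z : 'rV[R]_(n + n) => z ord0 l : R^o) y /\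
  'd (fun z : 'rV[R]_(n + n) => z ord0 l : R^o) y h = h ord0 l.
Proof.
have cl : continuous (@rcoord R _ l) by exact: coord_continuous.
split; first exact: differentiable_coord.
exact: (congr1 (@^~ h) (@diff_lin _ _ _ (@rcoord R _ l) y cl)).
Qed.

Definition fscale (lam : R) y : 'rV[R]_(n + n) := row_mx (lsubmx y) (lam *: rsubmx y).

Lemma fscale_linear lam : linear (fscale lam).
Proof.
move=> a x y; rewrite /fscale !linearP/= scale_row_mx add_row_mx; congr row_mx.
Qed.

HB.instance Definition _ lam :=
  GRing.isLinear.Build R 'rV[R]_(n + n) 'rV[R]_(n + n) *:%R (fscale lam) (fscale_linear lam).

Lemma fscaleEl lam y a : fscale lam y ord0 (lshift n a) = y ord0 (lshift n a).
Proof. by rewrite row_mxEl mxE. Qed.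

Lemma fscaleEr lam y a : fscale lam y ord0 (rshift n a) = lam * y ord0 (rshift n a).
Proof. by rewrite row_mxEr !mxE. Qed.

Lemma fscale_differentiable lam y : differentiable (fscale lam) y.
Proof.
apply: differentiable_row => l; case: (split_ordP l) => a ->.
  rewrite (_ : (fun _ => _) = fun z : 'rV[R]_(n + n) => z ord0 (lshift n a) : R^o).
    exact: differentiable_coord.
  by apply/funext => z; exact: fscaleEl.
rewrite (_ : (fun _ => _) = fun z : 'rV[R]_(n + n) => lam *: (z ord0 (rshift n a) : R^o)).
  apply: differentiableZ; exact: differentiable_coord.
by apply/funext => z; exact: fscaleEr.
Qed.

Lemma fscale_diff lam y h : 'd (fscale lam) y h = fscale lam h.
Proof.
have cl : continuous (fscale lam).
  by move=> z; exact/differentiable_continuous/fscale_differentiable.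
exact: (congr1 (@^~ h) (@diff_lin _ _ _ (fscale lam) y cl)).
Qed.

(** The coordinate expression of $q$ from a chart of $TM$ to the one of $\mathbb P(TM)$ where the
    [k]-th fibre coordinate is nonzero. *)
Definition proj_coord k y : 'rV[R]_(n + n.-1) :=
  row_mx (lsubmx y) (col' k ((rsubmx y ord0 k)^-1 *: rsubmx y)).

Lemma proj_coordEl k y a : proj_coord k y ord0 (lshift _ a) = y ord0 (lshift n a).
Proof. by rewrite row_mxEl mxE. Qed.

Lemma proj_coordEr k y b : proj_coord k y ord0 (rshift _ b) =
  (y ord0 (rshift n k))^-1 * y ord0 (rshift n (lift k b)).
Proof. by rewrite row_mxEr !mxE. Qed.

Lemma proj_coord_scale k lam y : lam != 0 -> proj_coord k (fscale lam y) = proj_coord k y.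
Proof.
move=> lam0; rewrite /proj_coord /fscale row_mxKl row_mxKr; congr (row_mx _ (col' _ _)).
by rewrite mxE invfM scalerA mulrAC mulVf// mul1r.
Qed.

Definition fibre_nz k : set 'rV[R]_(n + n) := [set y | y ord0 (rshift n k) != 0].

Lemma fibre_nz_open k : open (fibre_nz k).
Proof.
apply: (@open_comp _ _ (fun y : 'rV[R]_(n + n) => y ord0 (rshift n k)) [set x | x != 0]).
  by move=> y _; exact: coord_continuous.
exact: open_neq.
Qed.

Lemma proj_coord_Ck d k l : Ck_on d (fibre_nz k) (fun y => proj_coord k y ord0 l : R^o).
Proof.
have oA := @fibre_nz_open k.
have Cc (l' : 'I_(n + n)) : Ck_on d (fibre_nz k) (fun y => y ord0 l' : R^o).
  by apply: (@Ck_on_linear _ _ _ _ (@rcoord R _ l')); exact: coord_continuous.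
case: (split_ordP l) => a ->.
  by apply: (Ck_on_ext oA _ (Cc (lshift n a))) => y _; rewrite proj_coordEl.
have Ci := Ck_on_inv oA (fun y (Ay : fibre_nz k y) => Ay) (Cc (rshift n k)).
apply: (Ck_on_ext oA _ (Ck_onM oA Ci (Cc (rshift n (lift k a))))) => y _.
by rewrite proj_coordEr.
Qed.

Lemma proj_coord_differentiable k y : fibre_nz k y -> differentiable (proj_coord k) y.
Proof.
move=> yk; apply: differentiable_row => l.
by have [+ _] := proj_coord_Ck 1 k l; apply.
Qed.

Lemma proj_coord_diffl k y h a : fibre_nz k y ->
  'd (proj_coord k) y h ord0 (lshift _ a) = h ord0 (lshift n a).
Proof.
move=> yk; rewrite diff_coord; last exact: proj_coord_differentiable.
rewrite (_ : (fun _ => _) = fun y => y ord0 (lshift n a)).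
  exact: (coord_diff _ _ _).2.
by apply/funext => z; rewrite proj_coordEl.
Qed.

Lemma proj_coord_diffr k y h b : fibre_nz k y ->
  'd (proj_coord k) y h ord0 (rshift _ b) =
  (y ord0 (rshift n k))^-1 * (h ord0 (rshift n (lift k b)) -
   y ord0 (rshift n (lift k b)) / y ord0 (rshift n k) * h ord0 (rshift n k)).
Proof.
move=> yk; rewrite diff_coord; last exact: proj_coord_differentiable.
pose u z : R^o := (z : 'rV[R]_(n + n)) ord0 (rshift n k).
pose w z : R^o := (z : 'rV[R]_(n + n)) ord0 (rshift n (lift k b)).
rewrite (_ : (fun _ => _) = (fun z => (u z)^-1 : R^o) * w); last first.
  by apply/funext => z; rewrite proj_coordEr.
have [du duE] := coord_diff (rshift n k) y h.
have [dw dwE] := coord_diff (rshift n (lift k b)) y h.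
have dui : differentiable (fun z => (u z)^-1 : R^o) y by exact: differentiableV.
have E1 := congr1 (@^~ h) (diffM dui dw).
have E2 := congr1 (@^~ h) (diffV du yk).
refine (etrans E1 _); rewrite /= /GRing.scale_fun /= in E2 *.
refine (etrans (congr2 (fun s t => (u y)^-1 *: s + w y *: t) dwE E2) _).
rewrite -[X in _ + w y *: X]/(- (u y) ^- 2 * _).
refine (etrans (congr1 (fun t => (u y)^-1 *: (h ord0 (rshift n (lift k b)) : R^o) + w y *: (- (u y) ^- 2 * t)) duE) _).
rewrite /GRing.scale/= /u /w -exprVn; field; exact: yk.
Qed.

(** The kernel of $dq$ is the radial line: by the quotient rule, the fibre part of [h] must be
    proportional to that of [y], with the ratio read off at index [k]. *)
Lemma proj_coord_diff_ker k y h : fibre_nz k y -> 'd (proj_coord k) y h = 0 ->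
  h = row_mx 0 ((h ord0 (rshift n k) / y ord0 (rshift n k)) *: rsubmx y).
Proof.
move=> yk dh0; apply/rowP => l; case: (split_ordP l) => a ->.
  by rewrite row_mxEl mxE -(@proj_coord_diffl k y) ?dh0 ?mxE.
rewrite row_mxEr !mxE; case: (unliftP k a) => [b ->|->]; last by rewrite divfK.
have := proj_coord_diffr h b yk; rewrite dh0 mxE => /esym/eqP.
rewrite mulf_eq0 invr_eq0 (negbTE yk)/= subr_eq0 => /eqP ->; by field.
Qed.

End fibre_coordinates.

(** * The slit tangent bundle over its projectivization *)

Section projective_bundle.
Context (R : realType) (n : nat) (M : chartedSpace R n) (hM : smooth_manifold M).
Notation D := (chart_dom M).
Implicit Types (v w : TM0 M) (i j : chart_index M) (k : 'I_n).

Definition slit_base v : M := tbase (slit_val v).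
Definition slit_comp v i : 'rV[R]_n := tcomp (slit_val v) i.
Definition slit_chart i v : 'rV[R]_(n + n) := chart (TM0 M) i v.

Lemma slit_chartEr i v l : slit_chart i v ord0 (rshift n l) = slit_comp v i ord0 l.
Proof. by rewrite /slit_chart /= row_mxEr. Qed.

Lemma slit_comp_neq0 v i : D i (slit_base v) -> exists k, slit_comp v i ord0 k != 0.
Proof.
move=> iv; apply: contrapT => v0; apply: (@slitP _ _ _ v) => j.
have vi0 : tcomp (slit_val v) i = 0.
  apply/rowP => k; rewrite mxE; apply/eqP/negPn/negP => vk; apply: v0.
  by exists k.
have [vE v0'] := tcompP (slit_val v).
have [jv|jv] := pselect (D j (slit_base v)); last by rewrite v0'.
by rewrite (vE i j iv jv) vi0 linear0.
Qed.

Lemma slit_eq v w : tbase (slit_val v) = tbase (slit_val w) ->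
  (forall i, slit_comp v i = slit_comp w i) -> v = w.
Proof.
case: v w => -[p v vP] vn [[q w wP] wn] /=; rewrite /slit_comp /= => pq vw; subst q.
have ? : v = w by apply/funext.
subst w; have ? : vP = wP by exact: Prop_irrelevance.
by subst wP; congr SlitTangent; exact: Prop_irrelevance.
Qed.

Lemma slit_scale_scale lam mu (lam0 : lam != 0) (mu0 : mu != 0) nu (nu0 : nu != 0) v :
  nu = lam * mu -> slit_scale lam0 (slit_scale mu0 v) = slit_scale nu0 v.
Proof. by move=> nuE; apply: slit_eq => // i; rewrite /slit_comp /= scalerA nuE. Qed.

Lemma slit_scale_id lam (lam0 : lam != 0) v : lam = 1 -> slit_scale lam0 v = v.
Proof. by move=> l1; apply: slit_eq => // i; rewrite /slit_comp /= l1 scale1r. Qed.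

Lemma Rstar_orbit_refl v : Rstar_orbit v v.
Proof. by exists 1, (oner_neq0 R); rewrite slit_scale_id. Qed.

Lemma PTM_proj_eqP v w : PTM_proj v = PTM_proj w <-> exists lam (lam0 : lam != 0), w = slit_scale lam0 v.
Proof.
split=> [[vw]|[lam [lam0 ->]]].
  by have := Rstar_orbit_refl w; rewrite -vw.
have E : Rstar_orbit v = Rstar_orbit (slit_scale lam0 v).
  apply/seteqP; split => [_ [mu [mu0 ->]]|_ [mu [mu0 ->]]].
    have h : mu / lam != 0 by rewrite mulf_neq0// invr_neq0.
    by exists (mu / lam), h; rewrite (slit_scale_scale _ _ mu0)// divfK.
  have h : mu * lam != 0 by rewrite mulf_neq0.
  by exists (mu * lam), h; rewrite (slit_scale_scale _ _ h).
rewrite /PTM_proj; move: (ex_intro _ _ _) (ex_intro _ _ _); rewrite E => p q.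
congr ProjTangent; exact: Prop_irrelevance.
Qed.

Lemma PTM_proj_repr (L : PTM M) : PTM_proj (proj_repr L) = L.
Proof.
rewrite /PTM_proj; move: (ex_intro _ _ _); rewrite -(svalP (cid (proj_classP L))).
by case: L => c cP p; congr ProjTangent; exact: Prop_irrelevance.
Qed.

Lemma proj_repr_proj v : exists lam (lam0 : lam != 0), proj_repr (PTM_proj v) = slit_scale lam0 v.
Proof. by apply/PTM_proj_eqP; rewrite PTM_proj_repr. Qed.

Lemma slit_chart_scale i lam (lam0 : lam != 0) v :
  slit_chart i (slit_scale lam0 v) = fscale lam (slit_chart i v).
Proof. by rewrite /fscale /slit_chart /= row_mxKl row_mxKr. Qed.

Lemma PTM_dom_proj i k v : chart_dom (PTM M) (i, k) (PTM_proj v) <->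
  D i (slit_base v) /\ slit_comp v i ord0 k != 0.
Proof.
have [lam [lam0 E]] := proj_repr_proj v; rewrite /= E /= mxE.
by rewrite mulf_eq0 (negbTE lam0).
Qed.

Lemma PTM_chart_proj i k v :
  chart (PTM M) (i, k) (PTM_proj v) = proj_coord k (slit_chart i v).
Proof.
have [lam [lam0 E]] := proj_repr_proj v.
rewrite -(proj_coord_scale k (slit_chart i v) lam0) -slit_chart_scale -E.
by rewrite /proj_coord /slit_chart /= row_mxKl row_mxKr.
Qed.

(** Some fibre coordinate is nonzero at [v] and remains so nearby, which keeps the nearby vectors
    off the zero section. *)
Lemma slit_chart_near i j v : D i (slit_base v) -> D j (slit_base v) ->
  \forall y \near slit_chart i v, exists2 w, D i (slit_base w) /\ D j (slit_base w) &
    slit_chart i w = y.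
Proof.
move=> iv jv; have [k vk] := slit_comp_neq0 iv.
have H1 : \forall y \near slit_chart i v, fibre_nz k y.
  by apply: open_nbhs_nbhs; split; [exact: fibre_nz_open|rewrite /fibre_nz/= slit_chartEr].
have H2 := tangent_overlap_nbhs hM iv jv.
apply: filterS2 H1 H2 => y yk /(TM_image hM)[w [iw jw] wy].
have wnz : ~ zero_section w.
  move=> w0; move: yk; rewrite /fibre_nz/= -wy /= row_mxEr w0 mxE eqxx//.
by exists (SlitTangent wnz).
Qed.

Variables (X0 : vector_field (TM0 M)).

Lemma incl_related_comp (Xc : vector_field (TM M)) v i :
  vf_related (@TM0_incl R n M) X0 Xc -> D i (slit_base v) ->
  tcomp (X0 v) i = tcomp (Xc (slit_val v)) i.
Proof.
move=> rel iv; apply/esym; refine (etrans (rel v i i iv iv) _).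
have E : {near slit_chart i v, id =1
    coord_expr (N := TM0 M) i (fun p' => chart (TM M) i (TM0_incl p'))}.
  apply: filterS (slit_chart_near iv iv) => y [w [iw _] <-].
  by rewrite (coord_exprK (TM0_inj hM)).
have did : is_diff (slit_chart i v) id id by exact: is_diff_id.
have [_ dE] := near_eq_is_diff E (@ex_diff _ _ _ _ _ _ _ did).
exact: (etrans (congr1 (@^~ _) dE) (congr1 (@^~ _) (@diff_val _ _ _ _ _ _ _ did))).
Qed.

Lemma proj_related_comp (Y : vector_field (PTM M)) v i k :
  vf_related (@PTM_proj R n M) X0 Y -> D i (slit_base v) -> slit_comp v i ord0 k != 0 ->
  tcomp (Y (PTM_proj v)) (i, k) = 'd (proj_coord k) (slit_chart i v) (tcomp (X0 v) i).
Proof.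
move=> rel iv vk.
have dv : chart_dom (PTM M) (i, k) (PTM_proj v) by apply/PTM_dom_proj.
refine (etrans (rel v i (i, k) iv dv) _).
have E : {near slit_chart i v, proj_coord k =1
    coord_expr (N := TM0 M) i (fun p' => chart (PTM M) (i, k) (PTM_proj p'))}.
  apply: filterS (slit_chart_near iv iv) => y [w [iw _] <-].
  by rewrite (coord_exprK (TM0_inj hM))// PTM_chart_proj.
have nz : fibre_nz k (slit_chart i v) by rewrite /fibre_nz/= slit_chartEr.
have [_ dE] := near_eq_is_diff E (proj_coord_differentiable nz).
exact: (congr1 (@^~ _) dE).
Qed.

(* Since [X0] is related to a field on the projectivization, the components of
   [X0] at [v] and [lam v] can only differ by a multiple of [v]; the lifted
   functions [f^c], which are homogeneous in the fibres, exclude this. *)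
Lemma related_lift_homogeneous (X : vector_field M) (Xc : vector_field (TM M))
    (Y : vector_field (PTM M)) :
  complete_lift X Xc -> vf_related (@TM0_incl R n M) X0 Xc ->
  vf_related (@PTM_proj R n M) X0 Y ->
  forall v i lam (lam0 : lam != 0), D i (slit_base v) ->
  tcomp (X0 (slit_scale lam0 v)) i = fscale lam (tcomp (X0 v) i).
Proof.
move=> cl reli relp v i lam lam0 iv.
have [k vk] := slit_comp_neq0 iv.
set v' := slit_scale lam0 v.
have iv' : D i (slit_base v') by [].
have v'k : slit_comp v' i ord0 k != 0 by rewrite /slit_comp /= mxE mulf_neq0.
set y := slit_chart i v; pose y' := slit_chart i v'.
have y'E : fscale lam y = y' by rewrite /y' slit_chart_scale.
have yk : fibre_nz k y by rewrite /fibre_nz/= slit_chartEr.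
have yk' : fibre_nz k y' by rewrite /fibre_nz/= slit_chartEr.
set a := tcomp (X0 v') i; set b := tcomp (X0 v) i.
pose d := a - fscale lam b.
(* Both [v] and [v'] lie over the same line, where the field [Y] has one value. Since [proj_coord k]
   is invariant under [fscale lam], the two vectors [a] and [fscale lam b] have the same image at
   [y']. *)
have dP : 'd (proj_coord k) y' d = 0.
  have e1 := proj_related_comp relp iv vk; have e2 := proj_related_comp relp iv' v'k.
  have qE : PTM_proj v' = PTM_proj v by apply/esym/PTM_proj_eqP; exists lam, lam0.
  rewrite qE in e2.
  have E : {near y, proj_coord k =1 proj_coord k \o fscale lam}.
    by near=> z; rewrite /= proj_coord_scale.
  have [_ dE] := near_eq_chain_rule y'E (fscale_differentiable lam y)
     (proj_coord_differentiable yk') E.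
  have e3 := dE b; rewrite fscale_diff in e3.
  have e4 := etrans (esym e2) (etrans e1 e3).
  rewrite /d linearB; exact: (etrans (congr1 (fun s => s - _) e4) (subrr _)).
have := proj_coord_diff_ker yk' dP; set c := _ / _ => dE.
have vn0 : slit_comp v i != 0 by apply: contra vk => /eqP ->; rewrite mxE.
have [f smf fv] := bump_exists hM iv vn0.
have lift := complete_lift_scale hM smf cl lam iv.
pose F := lift_coord f i.
have dF : differentiable F y by exact: (lift_coord_diff hM smf iv).
have dF' : differentiable F y' by exact: (lift_coord_diff hM smf iv').
have Fs z : lam *: (F z : R^o) = F (fscale lam z).
  by rewrite /F /lift_coord /fscale row_mxKl row_mxKr linearZ.
(* Chain rule applied to the homogeneity relation [Fs]. *)
have FS : 'd F y' (fscale lam b) = lam * 'd F y b.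
  pose h z : R^o := lam *: (F z : R^o).
  have E : {near y, h =1 F \o fscale lam} by near=> z; exact: Fs.
  have [_ dE1] := near_eq_chain_rule y'E (fscale_differentiable lam y) dF' E.
  have e5 := congr1 ('d F y') (fscale_diff lam y b).
  exact: (etrans (esym e5) (etrans (esym (dE1 b)) (congr1 (@^~ b) (diffZ lam dF)))).
have FL : 'd F y' a = lam * 'd F y b.
  rewrite /a /b (incl_related_comp reli iv) (incl_related_comp reli iv').
  exact: lift.
have Fd : 'd F y' d = 0.
  rewrite /d linearB; exact: (etrans (congr2 (fun s t => s - t) FL FS) (subrr _)).
(* Euler's identity: the derivative of the homogeneous function [F] along the radial vector is
   [F y'], that is $\lambda\,df(v)$, which is nonzero by the choice of [f]. *)
have FV : 'd F y' (row_mx 0 (rsubmx y')) != 0.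
  rewrite -(deriveE _ dF') (_ : 'D_ _ F y' = lam * 'd (coord_expr (V := R^o) i f) (chart M i (slit_base v)) (slit_comp v i)).
    by rewrite mulf_neq0.
  set l := RHS; apply: cvg_lim; first exact: Rhausdorff.
  have Hl : (cst l : R -> R^o) t @[t --> 0^'] --> (l : R^o) by exact: cvg_cst.
  apply: cvg_trans Hl; apply: near_eq_cvg; near=> t.
  have t0 : t != 0 by near: t; exact: nbhs_dnbhs_neq.
  have e1 : F y' = l.
    by rewrite -y'E -Fs /F /lift_coord /y /slit_chart /= row_mxKl row_mxKr.
  have e2 : F (t *: row_mx 0 (rsubmx y') + y') = (t + 1) * F y'.
    have -> : t *: row_mx 0 (rsubmx y') + y' = fscale (t + 1) y'.
      rewrite -{2}(hsubmxK y') scale_row_mx add_row_mx /fscale scaler0 add0r.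
      by rewrite -{2}(scale1r (rsubmx y')) -scalerDl.
    by rewrite /F /lift_coord /fscale row_mxKl row_mxKr linearZ.
  by rewrite /= e2 e1 /GRing.scale/=; field.
have c0 : c = 0.
  have dE' : d = c *: row_mx 0 (rsubmx y') by rewrite dE scale_row_mx scaler0.
  move: Fd; rewrite dE' linearZ => /eqP; rewrite /GRing.scale/= mulf_eq0 (negbTE FV) orbF.
  by move/eqP.
by apply/eqP; rewrite -subr_eq0 -/d dE c0 scale0r row_mx0.
Unshelve. all: by end_near. Qed.

End projective_bundle.

(** * Solutions and their lifts *)

Section curves.
Context (R : realType).

Lemma ae_sub (P Q : R -> Prop) : (forall t, P t -> Q t) ->
  {ae (@lebesgue_measure R), forall t, P t} -> {ae (@lebesgue_measure R), forall t, Q t}.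
Proof. by move=> PQ [A [mA A0 PA]]; exists A; split => // t /= nQ; apply: PA => /= /PQ. Qed.

Lemma ae_and (P Q : R -> Prop) : {ae (@lebesgue_measure R), forall t, P t} ->
  {ae (@lebesgue_measure R), forall t, Q t} ->
  {ae (@lebesgue_measure R), forall t, P t /\ Q t}.
Proof.
have F := ae_filter_ringOfSetsType (@lebesgue_measure R).
by move=> aP aQ; apply: (@filterS2 _ _ F _ _ _ _ aP aQ) => t.
Qed.

Lemma near_in_oo (a b t : R) : a < t -> t < b -> \forall s \near t, a < s < b.
Proof.
move=> at_ tb; near=> s; apply/andP; split; near: s; [exact: lt_nbhsr|exact: lt_nbhsl].
Unshelve. all: by end_near. Qed.

Lemma is_derive_chain (V W : normedModType R) (c : R^o -> V) (Phi : V -> W)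
    (c' : R^o -> W) (t : R^o) (w : V) :
  is_derive t (1 : R^o) c w -> differentiable Phi (c t) ->
  (\forall s \near t, c' s = Phi (c s)) ->
  is_derive t (1 : R^o) c' ('d Phi (c t) w).
Proof.
move=> [dc cE] dPhi E.
have dct : differentiable c t by exact/derivable1_diffP.
have [dc' dE] := near_eq_chain_rule erefl dct dPhi E.
split; first exact/derivable1_diffP.
rewrite deriveE//; refine (etrans (dE 1) _).
by congr ('d Phi (c t) _); rewrite -cE deriveE.
Qed.

Lemma is_derive_row n (c : R^o -> 'rV[R]_n) (t : R^o) (w : 'rV[R]_n) :
  is_derive t (1 : R^o) c w <->
  forall l, is_derive t (1 : R^o) (fun s => c s ord0 l : R^o) (w ord0 l : R^o).
Proof.
split=> [[dc cE] l|H].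
  split; first by have /derivable_mxP := dc; apply.
  by have := congr1 (fun A : 'rV_n => A ord0 l) (derive_mx dc); rewrite cE mxE.
have dc : derivable c t (1 : R^o).
  by apply/derivable_mxP => i l; rewrite (ord1 i); have [] := H l.
split => //; rewrite derive_mx//; apply/rowP => l; rewrite mxE.
by have [_] := H l.
Qed.

Lemma within_continuous_sub (T : topologicalType) (f : R -> T) (a b c d : R) :
  a <= c -> d <= b -> {within `[a, b], continuous f} -> {within `[c, d], continuous f}.
Proof.
move=> ac db; apply: continuous_subspaceW => t /=; rewrite !in_itv/= => /andP[ct td].
by rewrite (le_trans ac ct) (le_trans td db).
Qed.

Lemma within_continuous_comp (V W : topologicalType) (A : set R) (f : R -> V) (h : V -> W) :
  {within A, continuous f} -> (forall t, A t -> {for f t, continuous h}) ->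
  {within A, continuous (h \o f)}.
Proof.
move=> /subspace_continuousP fc hc; apply/subspace_continuousP => t At.
by apply: cvg_comp; [exact: fc|exact: hc].
Qed.

End curves.

Section solutions.
Context (R : realType) (n m : nat) (N : chartedSpace R n).
Implicit Types (S : control_system N m) (u : R -> 'rV[R]_m) (g : R -> N) (a b c : R).

Definition chart_solution S u a b g (i : chart_index N) :=
  abs_continuous a b (fun t => chart N i (g t)) /\
  {ae lebesgue_measure, forall t : R, t \in `]a, b[ ->
     is_derive (t : R^o) (1 : R^o) (fun s => chart N i (g s))
               (velocity_comp S (u t) (g t) i)}.

(** The notion [solution] on an arbitrary interval, so that solutions can be cut and glued without
    shifting the control in time. *)
Definition solution_on S u a b g :=
  {within `[a, b], continuous g} /\
  forall i c d, a <= c -> c <= d -> d <= b ->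
    (forall t, c <= t <= d -> chart_dom N i (g t)) -> chart_solution S u c d g i.

Lemma solution_onE S u T g : solution S u T g <-> solution_on S u 0 T g.
Proof.
split=> -[gc H]; split=> // i c d c0 cd dT dom; apply: H => // t tcd; apply: dom.
Qed.

Lemma chart_solution_ext S u a b g g' i : (forall t, a <= t <= b -> g t = g' t) ->
  chart_solution S u a b g i -> chart_solution S u a b g' i.
Proof.
move=> gg' [gac gae]; split.
  by apply: ac_ext gac => t /gg' ->.
apply: ae_sub gae => t H tab; have {H} := H tab.
move: tab; rewrite in_itv/= => /andP[at_ tb].
rewrite gg' ?(ltW at_) ?ltW//; apply: near_eq_is_derive.
by apply: filterS (near_in_oo at_ tb) => s /andP[/ltW as_ /ltW sb]; rewrite gg'// as_.
Qed.

Lemma solution_on_ext S u a b g g' : (forall t, a <= t <= b -> g t = g' t) ->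
  solution_on S u a b g -> solution_on S u a b g'.
Proof.
move=> gg' [gc H]; split.
  apply: (subspace_eq_continuous _ gc) => t; rewrite inE/= in_itv/=; exact: gg'.
move=> i c d ac cd db dom.
have sub t : c <= t <= d -> a <= t <= b.
  by move=> /andP[ct td]; rewrite (le_trans ac ct) (le_trans td db).
apply: (@chart_solution_ext _ _ _ _ g) => [t /sub/gg'//|].
by apply: H => // t tcd; rewrite gg'; [exact: dom|exact: sub].
Qed.

Lemma solution_on_sub S u a b c d g : a <= c -> d <= b ->
  solution_on S u a b g -> solution_on S u c d g.
Proof.
move=> ac db [gc H]; split; first exact: within_continuous_sub gc.
by move=> i s t cs st td; apply: H => //; [exact: le_trans cs|exact: le_trans db].
Qed.

Lemma ae_neq b : {ae (@lebesgue_measure R), forall t : R, t != b}.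
Proof.
exists [set b]; split; first exact: measurable_set1.
  exact: lebesgue_measure_set1.
by move=> t /= /negP; rewrite negbK => /eqP.
Qed.

(** The junction time [b] is a null set, so no derivative is required there. *)
Lemma chart_solution_glue S u a b c g i :
  chart_solution S u a b g i -> chart_solution S u b c g i -> chart_solution S u a c g i.
Proof.
move=> [gab dab] [gbc dbc]; split; first exact: ac_glue gbc.
apply: ae_sub (ae_and dab (ae_and dbc (ae_neq b))) => t [Hab [Hbc tb]].
rewrite in_itv/= => /andP[at_ tc].
have [tb'|bt|tb'] := ltgtP t b; last by rewrite tb' eqxx in tb.
  by apply: Hab; rewrite in_itv/= at_.
by apply: Hbc; rewrite in_itv/= bt.
Qed.

Lemma solution_on_glue S u a b c g : a <= b -> b <= c ->
  solution_on S u a b g -> solution_on S u b c g -> solution_on S u a c g.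
Proof.
move=> ab bc [gab Hab] [gbc Hbc]; split.
  have -> : `[a, c]%classic = `[a, b]%classic `|` `[b, c]%classic :> set R.
    apply/seteqP; split=> t /=; rewrite !in_itv/=.
      by move=> /andP[-> ->]; rewrite andbT; apply/orP; exact: le_total.
    by move=> [/andP[-> tb]|/andP[bt ->]]; rewrite ?(le_trans tb bc)// (le_trans ab bt).
  by apply: withinU_continuous => //; exact: itv_closed.
move=> i s t as_ st tc dom.
have [tb|bt] := leP t b; first exact: Hab.
have [bs|sb] := leP b s; first exact: Hbc.
apply: (@chart_solution_glue _ _ _ b).
  apply: Hab => //; first exact: ltW.
  by move=> x /andP[sx xb]; apply: dom; rewrite sx (le_trans xb)// ltW.
apply: Hbc => //; first exact: ltW.
by move=> x /andP[bx xt]; apply: dom; rewrite xt andbT (le_trans _ bx)// ltW.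
Qed.

Lemma solution_on_concat S u a b c g g' : a <= b -> b <= c -> g b = g' b ->
  solution_on S u a b g -> solution_on S u b c g' ->
  solution_on S u a c (fun t => if t <= b then g t else g' t).
Proof.
move=> ab bc gb sg sg'; apply: (solution_on_glue ab bc).
  by apply: solution_on_ext sg => t /andP[_ ->].
apply: solution_on_ext sg' => t /andP[bt _]; case: ifPn => // tb.
by have -> : t = b by apply/le_anti; rewrite tb.
Qed.

Lemma solution_on_point S u a g : solution_on S u a a g.
Proof.
split; first by rewrite set_itv1; exact: continuous_subspace1.
move=> i c d ac cd da _.
have -> : c = a by apply/le_anti; rewrite ac (le_trans cd da).
have -> : d = a by apply/le_anti; rewrite da (le_trans ac cd).
split.
  apply: (@ac_lipschitz _ _ _ _ _ 0) => s t as_ st ta.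
  have -> : t = s by apply/le_anti; rewrite st (le_trans ta as_).
  by rewrite subrr normr0 mul0r.
apply: aeW => t; rewrite in_itv/= => /andP[at_ ta].
by have := lt_trans at_ ta; rewrite ltxx.
Qed.

Lemma chart_curve_continuous (g : R -> N) a b i :
  (forall t, a <= t <= b -> chart_dom N i (g t)) ->
  {within `[a, b], continuous (fun t => chart N i (g t))} ->
  {within `[a, b], continuous g}.
Proof.
move=> dom /subspace_continuousP gc; apply/subspace_continuousP => t tab A.
have tab' : a <= t <= b by move: tab; rewrite /= in_itv.
rewrite nbhsE => -[A' [oA' A't] A'A]; have [B oB HB] := oA' i.
have := gc t tab B; rewrite {1}/nbhs/= => /(_ _) H.
have {}H := H (open_nbhs_nbhs (conj oB ((HB _ (dom _ tab')).1 A't))).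
move: H; rewrite /nbhs/= /within/=; apply: filterS => s Bs sab.
apply: A'A; apply/HB; last exact: Bs.
by apply: dom; move: sab; rewrite /= in_itv.
Qed.

(** For a fixed control value the velocity is a linear combination of the fields. One linear
    relation between field components therefore covers changes of chart, the projection and fibre
    scaling. *)
Lemma velocity_comp_linear (n' : nat) (N' : chartedSpace R n') (S : control_system N m)
    (S' : control_system N' m) x p q i j (L : {linear 'rV[R]_n -> 'rV[R]_n'}) :
  tcomp (drift S' q) j = L (tcomp (drift S p) i) ->
  (forall k, tcomp (controlled S' k q) j = L (tcomp (controlled S k p) i)) ->
  velocity_comp S' x q j = L (velocity_comp S x p i).
Proof.
move=> dE cE; rewrite /velocity_comp linearD dE linear_sum; congr (_ + _).
by apply: eq_bigr => k _; rewrite linearZ cE.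
Qed.

End solutions.

Lemma open_nbhs_forall (T : topologicalType) (A : set T) :
  (forall x, A x -> nbhs x A) -> open A.
Proof. by move=> H; rewrite openE. Qed.

Section unproj.
Context (R : realType) (n : nat).
Implicit Types (k : 'I_n).

(* Section of [proj_coord k]: the k-th fibre coordinate is set to 1. *)
Definition unproj k (y : 'rV[R]_(n + n.-1)) : 'rV[R]_(n + n) :=
  row_mx (lsubmx y) (\row_b if unlift k b is Some c then rsubmx y ord0 c else 1).

Lemma unprojEl k y a : unproj k y ord0 (lshift n a) = y ord0 (lshift _ a).
Proof. by rewrite row_mxEl mxE. Qed.

Lemma unprojEr k y b : unproj k y ord0 (rshift n (lift k b)) = y ord0 (rshift _ b).
Proof. by rewrite row_mxEr mxE liftK mxE. Qed.

Lemma unprojE1 k y : unproj k y ord0 (rshift n k) = 1.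
Proof. by rewrite row_mxEr mxE unlift_none. Qed.

Lemma unproj_proj k (z : 'rV[R]_(n + n)) : z ord0 (rshift n k) = 1 ->
  unproj k (proj_coord k z) = z.
Proof.
move=> zk; apply/rowP => l; case: (split_ordP l) => a ->.
  by rewrite unprojEl proj_coordEl.
case: (unliftP k a) => [b ->|->]; last by rewrite unprojE1.
by rewrite unprojEr proj_coordEr zk invr1 mul1r.
Qed.

Lemma unproj_continuous k : continuous (unproj k).
Proof.
move=> y; apply: differentiable_continuous; apply: differentiable_row => l.
case: (split_ordP l) => a ->.
  rewrite (_ : (fun _ => _) = fun z : 'rV[R]_(n + n.-1) => z ord0 (lshift _ a) : R^o).
    exact: differentiable_coord.
  by apply/funext => z; exact: unprojEl.
case: (unliftP k a) => [b ->|->].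
  rewrite (_ : (fun _ => _) = fun z : 'rV[R]_(n + n.-1) => z ord0 (rshift _ b) : R^o).
    exact: differentiable_coord.
  by apply/funext => z; exact: unprojEr.
rewrite (_ : (fun _ => _) = cst (1 : R^o)); first exact: differentiable_cst.
by apply/funext => z; exact: unprojE1.
Qed.

Lemma ac_unproj k (c : R -> 'rV[R]_(n + n.-1)) a b :
  abs_continuous a b c -> abs_continuous a b (unproj k \o c).
Proof.
move=> /ac_rowP cac; apply/ac_rowP => l; case: (split_ordP l) => d ->.
  by apply: ac_ext (cac (lshift _ d)) => t _; rewrite /= unprojEl.
case: (unliftP k d) => [e ->|->].
  by apply: ac_ext (cac (rshift _ e)) => t _; rewrite /= unprojEr.
by apply: ac_ext (ac_cst (1 : R^o) a b) => t _; rewrite /= unprojE1.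
Qed.

End unproj.

(** * Change of chart and projection of solutions *)

Section bundle_solutions.
Context (R : realType) (n m : nat) (M : chartedSpace R n) (hM : smooth_manifold M).
Notation D := (chart_dom M).
Variables (S0 : control_system (TM0 M) m) (Sp : control_system (PTM M) m).
Implicit Types (u : R -> 'rV[R]_m) (i j : chart_index M) (k : 'I_n).

Lemma slit_transition_diff i j (v : TM0 M) : D i (slit_base v) -> D j (slit_base v) ->
  differentiable (tangent_transition (M := M) i j) (slit_chart i v).
Proof.
move=> iv jv; apply: (tangent_transition_diff hM).
exact: (nbhs_singleton (tangent_overlap_nbhs hM iv jv)).
Qed.

Lemma slit_comp_transition (X : vector_field (TM0 M)) (v : TM0 M) i j :
  D i (slit_base v) -> D j (slit_base v) ->
  tcomp (X v) j = 'd (tangent_transition (M := M) i j) (slit_chart i v) (tcomp (X v) i).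
Proof.
move=> iv jv; have [vE _] := tcompP (X v).
rewrite vf_base in vE; refine (etrans (vE i j iv jv) _).
have E : {near slit_chart i v, tangent_transition (M := M) i j =1
    coord_expr (N := TM0 M) i (chart (TM0 M) j)}.
  apply: filterS (slit_chart_near hM iv jv) => y [w [iw jw] <-].
  by rewrite (coord_exprK (TM0_inj hM))// (tangent_transitionE hM).
have [_ dE] := near_eq_is_diff E (slit_transition_diff iv jv).
exact: (congr1 (@^~ _) dE).
Qed.

(** A lift is built in a single chart, while [solution_on] tests all of them. The tangent transition
    maps are $C^1$, so they preserve absolute continuity and transport velocities by the chain
    rule. *)
Lemma slit_solution u a b (g : R -> TM0 M) i :
  (forall t, a <= t <= b -> D i (slit_base (g t))) ->
  chart_solution S0 u a b g i -> solution_on S0 u a b g.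
Proof.
move=> dom [gac gae]; split.
  by apply: (@chart_curve_continuous _ _ (TM0 M) g a b i) => //; exact: ac_continuous.
move=> j c d ac cd db domj.
have domi t : c <= t <= d -> D i (slit_base (g t)).
  by move=> /andP[ct td]; apply: dom; rewrite (le_trans ac ct) (le_trans td db).
have trE t : c <= t <= d ->
    tangent_transition (M := M) i j (slit_chart i (g t)) = chart (TM0 M) j (g t).
  by move=> tcd; apply: (tangent_transitionE hM); [exact: domi|exact: domj].
split.
  apply/ac_rowP => l; apply: (@ac_ext _ _ (fun t => tangent_transition (M := M) i j
      (slit_chart i (g t)) ord0 l : R^o)) => [t /trE ->//|].
  apply: (@ac_C1_comp _ _ (tangent_overlap (M := M) i j)
    (fun y => tangent_transition i j y ord0 l)).
  - exact: (tangent_overlap_open hM).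
  - move=> t tcd; exact: (nbhs_singleton (tangent_overlap_nbhs hM (domi _ tcd) (domj _ tcd))).
  - exact: (tangent_transition_Ck hM).
  - exact: ac_sub gac.
apply: ae_sub gae => t H; rewrite in_itv/= => /andP[ct td].
have tcd : c <= t <= d by rewrite !ltW.
have it := domi _ tcd; have jt := domj _ tcd.
have {}H : is_derive (t : R^o) (1 : R^o) (fun s => slit_chart i (g s))
    (velocity_comp S0 (u t) (g t) i).
  by apply: H; rewrite in_itv/= (le_lt_trans ac ct) (lt_le_trans td db).
have -> : velocity_comp S0 (u t) (g t) j =
    'd (tangent_transition (M := M) i j) (slit_chart i (g t)) (velocity_comp S0 (u t) (g t) i).
  by apply: velocity_comp_linear => [|x]; exact: slit_comp_transition.
apply: is_derive_chain H _ _; first exact: slit_transition_diff.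
apply: filterS (near_in_oo ct td) => s /andP[/ltW cs /ltW sd].
by rewrite trE// cs.
Qed.

Lemma PTM_proj_continuous : continuous (@PTM_proj R n M : TM0 M -> PTM M).
Proof.
apply/continuousP => A oA; change (chart_open (@PTM_proj R n M @^-1` A)) => i.
have HB k := oA (i, k).
(* Every slit vector has a nonzero component in the chart [i], so the charts [(i, k)] together cover
   the lines over that chart. *)
exists (\bigcup_k (fibre_nz k `&` proj_coord k @^-1` s2val (cid2 (HB k)))).
  apply: bigcup_open => k _; case: cid2 => /= B oB _.
  apply: open_nbhs_forall => y [yk yB]; apply: filterI.
    by apply: open_nbhs_nbhs; split => //; exact: fibre_nz_open.
  apply: (differentiable_continuous (proj_coord_differentiable yk)).
  exact: open_nbhs_nbhs.
move=> v iv; split.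
  move=> Av; have [k vk] := slit_comp_neq0 iv; exists k => //.
  have dv : chart_dom (PTM M) (i, k) (PTM_proj v) by apply/PTM_dom_proj.
  split; first by rewrite /fibre_nz /= -[row_mx _ _]/(@slit_chart R n M i v) slit_chartEr.
  case: cid2 => /= B oB /(_ _ dv)[+ _] => /(_ Av).
  by rewrite -PTM_chart_proj.
move=> [k _]; case: cid2 => /= B oB HB' [vk Bv].
have dv : chart_dom (PTM M) (i, k) (PTM_proj v).
  by apply/PTM_dom_proj; split => //; rewrite -slit_chartEr.
by move: Bv; rewrite -PTM_chart_proj => /(HB' _ dv).
Qed.

Hypothesis hSp : system_related (@PTM_proj R n M) S0 Sp.

Lemma velocity_comp_proj (x : 'rV[R]_m) (v : TM0 M) i k :
  D i (slit_base v) -> slit_comp v i ord0 k != 0 ->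
  velocity_comp Sp x (PTM_proj v) (i, k) =
  'd (proj_coord k) (slit_chart i v) (velocity_comp S0 x v i).
Proof.
move=> iv vk; have [hd hc] := hSp.
by apply: velocity_comp_linear => [|l]; apply: (proj_related_comp hM).
Qed.

Lemma solution_on_proj u a b (g : R -> TM0 M) :
  solution_on S0 u a b g -> solution_on Sp u a b (@PTM_proj R n M \o g).
Proof.
move=> [gc H]; split.
  by apply: within_continuous_comp gc _ => t _; exact: PTM_proj_continuous.
move=> [i k] c d ac cd db dom.
have domi t : c <= t <= d -> D i (slit_base (g t)) /\ slit_comp (g t) i ord0 k != 0.
  by move=> /dom /PTM_dom_proj.
have nz t : c <= t <= d -> fibre_nz k (slit_chart i (g t)).
  by move=> /domi[_]; rewrite /fibre_nz/= slit_chartEr.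
have [gac gae] : chart_solution S0 u c d g i by apply: H => // t /domi[].
split.
  apply/ac_rowP => l; apply: (@ac_ext _ _ (fun t => proj_coord k (slit_chart i (g t)) ord0 l : R^o)).
    by move=> t _; rewrite /= -PTM_chart_proj.
  apply: (@ac_C1_comp _ _ (fibre_nz k) (fun y => proj_coord k y ord0 l)) => //.
  - exact: fibre_nz_open.
  - exact: proj_coord_Ck.
apply: ae_sub gae => t Hd tcd; have {}Hd := Hd tcd.
move: tcd; rewrite in_itv/= => /andP[ct td].
have tcd : c <= t <= d by rewrite !ltW.
have [it kt] := domi _ tcd.
rewrite velocity_comp_proj//; apply: is_derive_chain Hd _ _.
  exact: (proj_coord_differentiable (nz _ tcd)).
by near=> s; exact: PTM_chart_proj.
Unshelve. all: by end_near. Qed.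

End bundle_solutions.

(** * Lifting projective solutions *)

Section lifting.
Context (R : realType) (n m : nat) (M : chartedSpace R n) (hM : smooth_manifold M).
Notation D := (chart_dom M).
Implicit Types (u : R -> 'rV[R]_m) (i j : chart_index M) (k l : 'I_n).

Lemma normalized_repr (L : PTM M) i k : chart_dom (PTM M) (i, k) L ->
  exists e : TM0 M, [/\ PTM_proj e = L, D i (slit_base e),
    slit_comp e i ord0 k = 1 & slit_chart i e = unproj k (chart (PTM M) (i, k) L)].
Proof.
rewrite -{1}(PTM_proj_repr L) => /PTM_dom_proj[iv vk].
have vk' : (slit_comp (proj_repr L) i ord0 k)^-1 != 0 by rewrite invr_eq0.
have e1 : slit_comp (slit_scale vk' (proj_repr L)) i ord0 k = 1.
  by rewrite /slit_comp /= mxE mulVf.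
have qE : PTM_proj (slit_scale vk' (proj_repr L)) = L.
  rewrite -[RHS]PTM_proj_repr; apply/esym/PTM_proj_eqP.
  by exists (slit_comp (proj_repr L) i ord0 k)^-1, vk'.
exists (slit_scale vk' (proj_repr L)); split => //.
rewrite -[in RHS]qE PTM_chart_proj unproj_proj//.
by rewrite slit_chartEr.
Qed.

(** Keeps a continuous curve in the domain of one chart for a short time around each instant. *)
Lemma PTM_dom_open i k : open (chart_dom (PTM M) (i, k) : set (PTM M)).
Proof.
change (chart_open (chart_dom (PTM M) (i, k) : set (PTM M))) => -[j l].
(* Seen in the chart [(j, l)], a line is lifted by [unproj l] and moved to the chart [i]; membership
   in the domain is then the nonvanishing of its [k]-th fibre coordinate. *)
pose Q (z : 'rV[R]_(n + n)) := tangent_overlap (M := M) j i z /\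
  tangent_transition (M := M) j i z ord0 (rshift n k) != 0.
exists (unproj l @^-1` Q).
  apply: open_comp; first by move=> y _; exact: unproj_continuous.
  apply: open_nbhs_forall => z [oz nz].
  have H1 : nbhs z (tangent_overlap (M := M) j i).
    by apply: open_nbhs_nbhs; split => //; exact: (tangent_overlap_open hM).
  have tc : {for z, continuous (fun z => tangent_transition (M := M) j i z ord0 (rshift n k) : R^o)}.
    exact: (@tangent_transition_Ck R n M hM 0 j i (rshift n k) z oz).
  have H2 := tc _ (open_nbhs_nbhs (conj (@open_neq _ (0 : R^o)) nz)).
  by apply: filterS2 H1 H2 => y ? ?; split.
move=> L /normalized_repr[e [<- je e1 eE]].
rewrite -[(unproj l @^-1` Q) _]/(Q (unproj l _)) -eE; split.
  move=> /PTM_dom_proj[ie ke]; split.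
    exact: (nbhs_singleton (tangent_overlap_nbhs hM je ie)).
  rewrite (tangent_transitionE hM je ie).
  by rewrite -[chart _ _ _]/(slit_chart i e) slit_chartEr.
move=> [oe ke]; apply/PTM_dom_proj.
have ie : D i (slit_base e).
  have [p [jp ip]] := oe; rewrite /slit_chart /= row_mxKl.
  by move=> /(chart_inj hM jp je) <-.
split => //; move: ke; rewrite (tangent_transitionE hM je ie).
by rewrite -[chart _ _ _]/(slit_chart i e) slit_chartEr.
Qed.

Variables (S0 : control_system (TM0 M) m) (Sp : control_system (PTM M) m).
Hypothesis hSp : system_related (@PTM_proj R n M) S0 Sp.
Hypothesis hom0 : forall (x : 'rV[R]_m) (v : TM0 M) i lam (lam0 : lam != 0),
  D i (slit_base v) ->
  velocity_comp S0 x (slit_scale lam0 v) i = fscale lam (velocity_comp S0 x v i).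

(** Along a continuous curve the field components are continuous, hence Borel; only the controls
    bring in Lebesgue measurability. *)
Lemma ae_measurable_velocity u a b (e : R -> TM0 M) i (l : 'I_(n + n)) :
  (forall t, a <= t <= b -> D i (slit_base (e t))) ->
  {within `[a, b], continuous (fun t => slit_chart i (e t))} ->
  (forall k : 'I_m, lebesgue_measurable_fun (fun t => u t ord0 k)) ->
  ae_measurable `[a, b] (fun t => velocity_comp S0 (u t) (e t) i ord0 l).
Proof.
move=> dom ec um; have mab : measurable (`[a, b]%classic : set R) by exact: measurable_itv.
have mX (X : vector_field (TM0 M)) : ae_measurable `[a, b] (fun t => tcomp (X (e t)) i ord0 l).
  apply: measurable_ae; apply: subspace_continuous_measurable_fun => //.
  apply: (subspace_eq_continuous (f := fun t => coord_expr (N := TM0 M) i (fun v => tcomp (X v) i) (slit_chart i (e t)) ord0 l)).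
    move=> t; rewrite inE/= in_itv/= => tab.
    by rewrite (coord_exprK (TM0_inj hM))//; exact: dom.
  apply: (@within_continuous_comp _ _ _ _ _ (fun y => coord_expr (N := TM0 M) i (fun v => tcomp (X v) i) y ord0 l)) => //.
  move=> t; rewrite /= in_itv/= => tab.
  apply: (@continuous_comp _ _ _ (coord_expr (N := TM0 M) i (fun v => tcomp (X v) i)) (fun y => y ord0 l)).
    by apply: (vf_smooth X i 0); exists (e t) => //; exact: dom.
  exact: coord_continuous.
rewrite (_ : (fun _ => _) = (fun t => tcomp (drift S0 (e t)) i ord0 l) \+
    (fun t => \sum_k u t ord0 k * tcomp (controlled S0 k (e t)) i ord0 l)); last first.
  apply/funext => t; rewrite /velocity_comp mxE summxE; congr (_ + _).
  by apply: eq_bigr => k _; rewrite mxE.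
apply: (ae_measurable2 (op := fun g h => g \+ h)) => //.
  by move=> *; exact: measurable_funD.
apply: ae_measurable_sum => // k.
apply: (ae_measurableM (f := fun t => u t ord0 k)) => //.
apply: (@ae_measurable_sub _ _ setT) => //; exact: lebesgue_ae_measurable.
Qed.

Lemma bounded_velocity u a b (e : R -> TM0 M) i (l : 'I_(n + n)) C : a <= b ->
  (forall t, a <= t <= b -> D i (slit_base (e t))) ->
  {within `[a, b], continuous (fun t => slit_chart i (e t))} ->
  (forall t, a <= t <= b -> `|u t| <= C) ->
  exists B, forall t, a <= t <= b -> `|velocity_comp S0 (u t) (e t) i ord0 l| <= B.
Proof.
move=> ab dom ec uC.
have bX (X : vector_field (TM0 M)) : exists B, forall t, a <= t <= b -> `|tcomp (X (e t)) i| <= B.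
  have [|B HB] := @within_continuous_bounded _ _ (fun t => coord_expr (N := TM0 M) i (fun v => tcomp (X v) i) (slit_chart i (e t))) _ _ ab.
    apply: (@within_continuous_comp _ _ _ _ _ (coord_expr (N := TM0 M) i (fun v => tcomp (X v) i))) => //.
    move=> t; rewrite /= in_itv/= => tab.
    by apply: (vf_smooth X i 0); exists (e t) => //; exact: dom.
  exists B => t tab; have := HB t tab.
  by rewrite (coord_exprK (TM0_inj hM))//; exact: dom.
have [B0 HB0] := bX (drift S0).
have [B HB] := choice (fun q : 'I_m => bX (controlled S0 q)).
exists (B0 + \sum_k C * B k) => t tab.
apply: (le_trans (norm_coord_le _ _)); rewrite /velocity_comp.
apply: (le_trans (ler_normD _ _)); apply: lerD; first exact: HB0.
apply: (le_trans (ler_norm_sum _ _ _)); apply: ler_sum => k _.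
rewrite normrZ; apply: ler_pM => //; last exact: HB.
exact: (le_trans (norm_coord_le _ _) (uC _ tab)).
Qed.

(* Over a chart, the lift of [w] is [r e] where [e] is normalized to have k-th
   fibre component 1; matching the k-th components of the velocities forces
   [r' = mu r], where [mu] is the k-th component of the velocity at [e]. *)
Lemma local_lift u a b C (w : R -> PTM M) i k (v0 : TM0 M) : a <= b ->
  (forall k : 'I_m, lebesgue_measurable_fun (fun t => u t ord0 k)) ->
  (forall t, a <= t <= b -> `|u t| <= C) ->
  (forall t, a <= t <= b -> chart_dom (PTM M) (i, k) (w t)) ->
  solution_on Sp u a b w -> PTM_proj v0 = w a ->
  exists g : R -> TM0 M, [/\ solution_on S0 u a b g, g a = v0 &
    forall t, a <= t <= b -> PTM_proj (g t) = w t].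
Proof.
move=> ab um uC dom [wc wS] wa.
have [wac wae] : chart_solution Sp u a b w (i, k) by exact: wS.
(* The condition on [t] sits under the existential, with [v0] as default, so that choice yields a
   total function. *)
have He t : exists e : TM0 M, a <= t <= b -> [/\ PTM_proj e = w t, D i (slit_base e),
    slit_comp e i ord0 k = 1 & slit_chart i e = unproj k (chart (PTM M) (i, k) (w t))].
  have [tab|tab] := boolP (a <= t <= b); last by exists v0.
  by have [e He] := normalized_repr (dom t tab); exists e.
have [e {}He] := choice He.
have domi t : a <= t <= b -> D i (slit_base (e t)) by move=> /He[].
have eac : abs_continuous a b (fun t => slit_chart i (e t)).
  by apply: ac_ext (ac_unproj k wac) => t /He[_ _ _ ->].
have ec := ac_continuous eac.
pose mu t := velocity_comp S0 (u t) (e t) i ord0 (rshift n k).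
have [B HB] := bounded_velocity (rshift n k) ab domi ec uC.
have [F [Fa FL FD]] := lebesgue_primitive (ae_measurable_velocity (rshift n k) domi ec um) HB.
have aab : a <= a <= b by rewrite lexx.
have Fac : abs_continuous a b (F : R -> R^o) by exact: ac_lipschitz FL.
have [qea iea ea1 _] := He a aab.
have [lam [lam0 v0E]] : exists lam (lam0 : lam != 0), v0 = slit_scale lam0 (e a).
  by apply/PTM_proj_eqP; rewrite qea.
(* The solution of $r' = \mu r$ with $r(a) = \lambda$, because [F a] is 0. *)
pose r t := lam * expR (F t).
have r0 t : r t != 0 by rewrite mulf_neq0// gt_eqF// expR_gt0.
pose g t := slit_scale (r0 t) (e t).
have B0 : 0 <= B by apply: le_trans (HB a aab).
have Fle t : a <= t <= b -> `|F t| <= B * (b - a).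
  move=> /andP[at_ tb]; have := FL a t (lexx _) at_ tb; rewrite Fa subr0 => /le_trans; apply.
  by rewrite ler_wpM2l// lerD2r.
have rac : abs_continuous a b (r : R -> R^o).
  apply: (@ac_le _ _ _ (F : R -> R^o) _ _ _ (`|lam| * expR (B * (b - a)))) Fac => s t as_ st tb.
  (* From $e^{y-x} \ge 1 + y - x$: multiplied by $e^x$ it gives $e^x - e^y \le e^x (x-y)$. *)
  have expL x y : x <= B * (b - a) -> expR x - expR y <= expR (B * (b - a)) * `|x - y|.
    move=> xB; apply: (@le_trans _ _ (expR x * `|x - y|)); last first.
      by rewrite ler_wpM2r// ler_expR.
    have h := expR_ge1Dx (y - x).
    apply: (@le_trans _ _ (expR x * (x - y))); last by rewrite ler_wpM2l ?expR_ge0// ler_norm.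
    rewrite (_ : expR y = expR x * expR (y - x)); last by rewrite -expRD addrC subrK.
    have := expR_ge0 x; nra.
  rewrite /r -mulrBr normrM -mulrA; apply: ler_wpM2l => //.
  have sab : a <= s <= b by rewrite as_ (le_trans st).
  have tab : a <= t <= b by rewrite tb (le_trans as_).
  rewrite ler_norml -[X in X && _]lerN2 opprK opprB; apply/andP; split.
    rewrite (distrC (F t)); apply: expL; exact: (le_trans (ler_norm _) (Fle s sab)).
  apply: expL; exact: (le_trans (ler_norm _) (Fle t tab)).
have gE t : slit_chart i (g t) = fscale (r t) (slit_chart i (e t)) by exact: slit_chart_scale.
have domg t : a <= t <= b -> D i (slit_base (g t)) by exact: domi.
exists g; split; last first.
- move=> t /He[<- _ _ _]; apply/esym/PTM_proj_eqP; by exists (r t), (r0 t).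
- rewrite v0E /g; apply: slit_eq => // j.
  by rewrite /slit_comp /= /r Fa expR0 mulr1.
apply: (slit_solution hM domg); split.
  apply/ac_rowP => l; have /ac_rowP/(_ l) eacl := eac.
  case: (split_ordP l) eacl => d -> eacl.
    by apply: ac_ext eacl => t _; rewrite -[chart _ _ _]/(slit_chart i (g t)) gE fscaleEl.
  apply: ac_ext (acM rac eacl) => t _.
  by rewrite -[chart _ _ _]/(slit_chart i (g t)) gE fscaleEr.
apply: ae_sub (ae_and wae FD) => t [Hw HF] tab.
have {}Hw := Hw tab; have {}HF := HF tab.
move: tab; rewrite in_itv/= => /andP[at_ tb].
have tab : a <= t <= b by rewrite !ltW.
have [qe ie e1 eE] := He t tab.
have nz : fibre_nz k (slit_chart i (e t)) by rewrite /fibre_nz/= slit_chartEr e1 oner_eq0.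
have ek : slit_comp (e t) i ord0 k != 0 by rewrite e1 oner_eq0.
set V := velocity_comp S0 (u t) (e t) i.
have wV : velocity_comp Sp (u t) (w t) (i, k) = 'd (proj_coord k) (slit_chart i (e t)) V.
  by rewrite -qe; exact: (velocity_comp_proj hM).
have gV : velocity_comp S0 (u t) (g t) i = fscale (r t) V by exact: hom0.
rewrite gV; apply/is_derive_row => l.
have /is_derive_row Hwl := Hw.
have near_ab := near_in_oo at_ tb.
have dr : is_derive (t : R^o) (1 : R^o) (r : R^o -> R^o) (r t * V ord0 (rshift n k)).
  have de : is_derive (t : R^o) (1 : R^o) (expR \o F : R^o -> R^o) (expR (F t) * mu t).
    by apply: is_derive1_comp.
  have := is_deriveZ lam de; rewrite /GRing.scale/= mulrA; exact.
(* Base coordinates are those of [w], the [k]-th fibre coordinate is [r], and any other is [r] times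
   a coordinate of [w]. *)
case: (split_ordP l) => d ->.
  rewrite fscaleEl.
  have := Hwl (lshift _ d); rewrite wV proj_coord_diffl//.
  apply: near_eq_is_derive; apply: filterS near_ab => s /andP[/ltW as_ /ltW sb].
  have [_ _ _ sE] := He s (introT andP (conj as_ sb)).
  suff E : slit_chart i (g s) ord0 (lshift n d) = chart (PTM M) (i, k) (w s) ord0 (lshift _ d).
    exact: (esym E).
  by rewrite gE fscaleEl sE unprojEl.
rewrite fscaleEr; case: (unliftP k d) => [b' ->|->]; last first.
  apply: near_eq_is_derive dr; apply: filterS near_ab => s /andP[/ltW as_ /ltW sb].
  have [_ _ s1 _] := He s (introT andP (conj as_ sb)).
  suff E : slit_chart i (g s) ord0 (rshift n k) = r s by exact: (esym E).
  by rewrite gE fscaleEr slit_chartEr s1 mulr1.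
have dx := Hwl (rshift _ b').
apply: (@near_eq_is_derive _ _ _ ((r : R^o -> R^o) * (fun s => chart (PTM M) (i, k) (w s) ord0 (rshift _ b') : R^o))).
  apply: filterS near_ab => s /andP[/ltW as_ /ltW sb].
  have [_ _ _ sE] := He s (introT andP (conj as_ sb)).
  suff E : slit_chart i (g s) ord0 (rshift n (lift k b')) =
      r s * chart (PTM M) (i, k) (w s) ord0 (rshift _ b') by exact: (esym E).
  by rewrite gE fscaleEr sE unprojEr.
(* With $x$ the coordinate of [w] and $V$ the velocity at [e t], normalization gives $x' = V^b -
   xV^k$, so $(rx)' = rV^kx + rx' = rV^b$. *)
apply: (is_derive_eq (is_deriveM dr dx)).
rewrite wV proj_coord_diffr// slit_chartEr e1 invr1 mul1r mulr1 eE unprojEr.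
rewrite /GRing.scale/=; ring.
Qed.

(** Interval induction on the time up to which a lift from [v0] exists. Since [local_lift] accepts
    any initial vector over [w], a lift up to [s] extends over the whole neighbourhood of [t]
    covered by one chart. *)
Lemma global_lift u T (w : R -> PTM M) (v0 : TM0 M) : 0 <= T ->
  (forall k : 'I_m, lebesgue_measurable_fun (fun t => u t ord0 k)) ->
  [locally [bounded u t | t in [set: R]]] ->
  solution_on Sp u 0 T w -> PTM_proj v0 = w 0 ->
  exists g : R -> TM0 M, [/\ solution_on S0 u 0 T g, g 0 = v0 &
    forall t, 0 <= t <= T -> PTM_proj (g t) = w t].
Proof.
move=> T0 um ub wS w0.
apply: (@interval_induction _ 0 T (fun s => exists g : R -> TM0 M,
  [/\ solution_on S0 u 0 s g, g 0 = v0 & forall t, 0 <= t <= s -> PTM_proj (g t) = w t])) => //.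
  exists (cst v0); split => //; first exact: solution_on_point.
  by move=> t /andP[t0 t0']; have -> : t = 0 by apply/le_anti; rewrite t0'.
move=> t t0T; set v := proj_repr (w t).
have [i iv] := chart_cover hM (slit_base v).
have [k vk] := slit_comp_neq0 iv.
have dt : chart_dom (PTM M) (i, k) (w t) by [].
have [d d0 Hd] : exists2 d, 0 < d & forall s, 0 <= s <= T -> `|t - s| < d -> chart_dom (PTM M) (i, k) (w s).
  have /subspace_continuousP wc := wS.1.
  have tT : `[0, T]%classic t by rewrite /= in_itv.
  have := wc t tT _ (open_nbhs_nbhs (conj (PTM_dom_open i k) dt)).
  rewrite /nbhs/= /within/= => /nbhs_ballP[d d0 Hd].
  by exists d => // s s0T ts; apply: Hd => //; rewrite /= in_itv.
(* The controls are only locally bounded, so the neighbourhood of [t] is also shrunk to one where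
   [u] is bounded. *)
have [d' [C [d'0 HC]]] : exists d' C, 0 < d' /\ forall s, `|t - s| < d' -> `|u s| <= C.
  have [C0 [_ HC0]] := ub t I; have := HC0 (C0 + 1); rewrite ltrDl ltr01 => /(_ isT).
  rewrite /within/= => /nbhs_ballP[d' d'0 Hd']; exists d', (C0 + 1); split => // s ts.
  exact: Hd'.
exists (Num.min d d'); first by rewrite lt_min d0.
move=> s s' s0 ss' s'T ts s't [g [gS g0 gw]].
have Hin x : s <= x <= s' -> [/\ 0 <= x <= T, `|t - x| < d & `|t - x| < d'].
  move=> /andP[sx xs']; rewrite (le_trans s0 sx) (le_trans xs' s'T).
  suff : `|t - x| < Num.min d d' by rewrite lt_min => /andP[].
  by rewrite distrC ltr_distl (lt_le_trans ts sx) (le_lt_trans xs' s't).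
have [g' [g'S g's g'w]] : exists g' : R -> TM0 M, [/\ solution_on S0 u s s' g', g' s = g s &
    forall t, s <= t <= s' -> PTM_proj (g' t) = w t].
  apply: (@local_lift u s s' C w i k) => //.
  - by move=> x /Hin[_ _ /HC].
  - by move=> x /Hin[x0T xd _]; exact: Hd.
  - exact: solution_on_sub wS.
  - by apply: gw; rewrite s0 lexx.
exists (fun x => if x <= s then g x else g' x); split.
- by apply: (solution_on_concat s0 ss') => //; rewrite g's.
- by rewrite s0.
- move=> x /andP[x0 xs']; case: ifPn => xs; first by apply: gw; rewrite x0.
  by apply: g'w; rewrite xs' andbT ltW// ltNge.
Qed.

End lifting.

Theorem theorem4p5 (R : realType) (n m : nat) (M : chartedSpace R n)
    (hM : smooth_manifold M)
    (U : set 'rV[R]_m) (UU : set (R -> 'rV[R]_m)) (hUU : admissible_class U UU)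
    (S : control_system M m)
    (Sc : control_system (TM M) m) (hSc : lifted_system S Sc)
    (S0 : control_system (TM0 M) m) (hS0 : system_related (@TM0_incl R n M) S0 Sc)
    (Sp : control_system (PTM M) m) (hSp : system_related (@PTM_proj R n M) S0 Sp) :
  (controllable UU S0 -> controllable UU Sp) /\
  (controllable UU Sp ->
   forall p p' : TM0 M,
     exists (t : R) (u : R -> 'rV[R]_m) (lam : R) (lam0 : lam != 0),
       [/\ 0 < t, UU u & flows_to S0 t u p (slit_scale lam0 p')]).
Proof.
split=> ctrl.
  move=> L L'; have [t [u [t0 Uu [g [gS g0 gt]]]]] := ctrl (proj_repr L) (proj_repr L').
  exists t, u; split => //; exists (@PTM_proj R n M \o g).
  split; [|by rewrite /= g0 PTM_proj_repr|by rewrite /= gt PTM_proj_repr].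
  by apply/solution_onE; apply: (solution_on_proj hM hSp); apply/solution_onE.
move=> p p'; have [t [u [t0 Uu [w [wS w0 wt]]]]] := ctrl (PTM_proj p) (PTM_proj p').
have [_ um ub] := hUU u Uu.
(* Homogeneity holds for the drift and each controlled field, hence for the velocity at every
   control value. *)
have hom0 (x : 'rV[R]_m) (v : TM0 M) i lam (lam0 : lam != 0) : chart_dom M i (slit_base v) ->
    velocity_comp S0 x (slit_scale lam0 v) i = fscale lam (velocity_comp S0 x v i).
  move=> iv; apply: velocity_comp_linear => [|k].
    exact: (related_lift_homogeneous hM hSc.1 hS0.1 hSp.1).
  exact: (related_lift_homogeneous hM (hSc.2 k) (hS0.2 k) (hSp.2 k)).
have [g [gS g0 gw]] := global_lift hM hSp hom0 (ltW t0) um ub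
  ((solution_onE _ _ _ _).1 wS) (esym w0).
(* The lift ends over the line of [p']; its endpoint is known only up to a scalar, the origin of
   [lam]. *)
have [lam [lam0 E]] : exists lam (lam0 : lam != 0), g t = slit_scale lam0 p'.
  by apply/PTM_proj_eqP; rewrite -wt gw// lexx ltW.
exists t, u, lam, lam0; split => //; exists g; split => //.
Qed.
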